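(* Let $\mathscr{G}$ be a comonad on a bicategory $\mathscr{V}$ in $\mathrm{Caten}$. Then the bicategory $\mathscr{V}^{\mathscr{G}}$ (with its forgetful functor $\mathscr{U}:\mathscr{V}^{\mathscr{G}}\to\mathscr{V}$) is the object of Eilenberg–Moore $\mathscr{G}$-coalgebras for the comonad $\mathscr{G}$ in $\mathrm{Caten}$.
   Context: Notation. For a bicategory $\mathscr V$, $\mathscr V_V^{V'}=\mathscr V(V,V')$ is the hom category; horizontal composition is written $\otimes$ (so $v'\otimes v:V\to V''$ for $v:V\to V'$, $v':V'\to V''$); coherence isomorphisms are suppressed. Caten. $\mathrm{Caten}$ is the following tricategory (a bicategory if 3-cells are ignored; each hom $\mathrm{Caten}(\mathscr W,\mathscr V)$ is a 2-category). Objects are small bicategories. A morphism $\mathscr A:\mathscr W\to\mathscr V$ (a 2-sided enriched category) consists of a set $\mathrm{Ob}\mathscr A$ with functions $(-)_-:\mathrm{Ob}\mathscr A\to\mathrm{Ob}\mathscr W$ and $(-)_+:\mathrm{Ob}\mathscr A\to\mathrm{Ob}\mathscr V$; functors $\mathscr A_A^{A'}:\mathscr W_{A_-}^{A'_-}\to\mathscr V_{A_+}^{A'_+}$; 2-cells $\eta_A:1_{A_+}\to\mathscr A_A^A(1_{A_-})$ and natural 2-cells $\mu:\mathscr A_{A'}^{A''}(w')\otimes\mathscr A_A^{A'}(w)\to\mathscr A_A^{A''}(w'\otimes w)$ satisfying unit and associativity laws. Composition $\mathscr B\circ\mathscr A$: objects are pairs $(A,B)$ with $A_+=B_-$, homs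 are the composite functors, and $\mu,\eta$ are pasted. A 2-cell $F:\mathscr A\to\mathscr B$ (enriched functor) is a function $F:\mathrm{Ob}\mathscr A\to\mathrm{Ob}\mathscr B$ with $(FA)_\pm=A_\pm$, together with natural transformations $F_A^{A'}:\mathscr A_A^{A'}\Rightarrow\mathscr B_{FA}^{FA'}$ compatible with $\mu$ and $\eta$. A 3-cell $\psi:F\to E$ is a family of 2-cells $\psi_A:1_{A_+}\to\mathscr B_{FA}^{EA}(1_{A_-})$ with $\mu\circ(\psi_{A'}\otimes(F_A^{A'})_w)=\mu\circ((E_A^{A'})_w\otimes\psi_A):\mathscr A_A^{A'}(w)\to\mathscr B_{FA}^{EA'}(w)$ for all $w$. Comonads in Caten. A comonad on $\mathscr V$ in $\mathrm{Caten}$ is a morphism $\mathscr G:\mathscr V\to\mathscr V$ with enriched functors $\mathrm e:\mathscr G\to1_{\mathscr V}$, $\mathrm d:\mathscr G\to\mathscr G\circ\mathscr G$ satisfying the comonad laws. Explicitly: a set $\mathrm{Ob}\mathscr G$ with a function $G\mapsto G_0\in\mathrm{Ob}\mathscr V$ (so $G_-=G_+=G_0$), endofunctors $\mathscr G_G^{G'}$ of $\mathscr V_{G_0}^{G'_0}$, and natural 2-cells $\mu_{v',v}:\mathscr G_{G'}^{G''}(v')\otimes\mathscr G_G^{G'}(v)\to\mathscr G_G^{G''}(v'\otimes v)$, $\eta_G:1_{G_0}\to\mathscr G_G^G(1_{G_0})$, $\mathrm d_v:\mathscr G_G^{G'}v\to\mathscr G_G^{G'}\mathscr G_G^{G'}v$,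 $\mathrm e_v:\mathscr G_G^{G'}v\to v$ such that $(\mu,\eta)$ is associative and unital, each $(\mathscr G_G^{G'},\mathrm e,\mathrm d)$ is a comonad, and $\mathrm e\mu=\mathrm e\otimes\mathrm e$, $\mathrm e\eta=1$, $\mathrm d\,\mu_{v',v}=\mathscr G(\mu_{v',v})\,\mu_{\mathscr Gv',\mathscr Gv}(\mathrm d\otimes\mathrm d)$, $\mathrm d\eta=\mathscr G(\eta)\eta$. The bicategory $\mathscr V^{\mathscr G}$ has objects $\mathrm{Ob}\mathscr G$ and hom categories $\mathscr V^{\mathscr G}(G,G')$ the Eilenberg–Moore coalgebras $(v,\gamma_v:v\to\mathscr G_G^{G'}v)$ for the comonad $\mathscr G_G^{G'}$ on $\mathscr V_{G_0}^{G'_0}$; identities are $(1_{G_0},\eta_G)$ and $(v',\gamma_{v'})\otimes(v,\gamma_v)=(v'\otimes v,\mu_{v',v}(\gamma_{v'}\otimes\gamma_v))$. The strict functor $\mathscr U:\mathscr V^{\mathscr G}\to\mathscr V$ sends $G$ to $G_0$ and forgets coactions. It has a right adjoint $\mathscr R$ in $\mathrm{Caten}$ with $\mathrm{Ob}\mathscr R=\mathrm{Ob}\mathscr G$, $G_-=G_0$, $G_+=G$, $\mathscr R_G^{G'}v=(\mathscr G_G^{G'}v,\mathrm d_v)$, structure 2-cells those of $\mathscr G$; the counit is $\mathrm e$ and the unit $\mathrm g:1\to\mathscr R\circ\mathscr U$ has component $\gamma_v$ at $(v,\gamma_v)$. Eilenberg–Moore object. In the sense of Street's formal theory of (co)monads,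 this says that $\mathscr U$, with its coaction $\mathscr U\circ\mathrm g:\mathscr U\to\mathscr G\circ\mathscr U$, is the universal $\mathscr G$-coalgebra: for every bicategory $\mathscr X$, the adjunction $\mathrm{Caten}(\mathscr X,\mathscr U)\dashv\mathrm{Caten}(\mathscr X,\mathscr R)$ between $\mathrm{Caten}(\mathscr X,\mathscr V^{\mathscr G})$ and $\mathrm{Caten}(\mathscr X,\mathscr V)$ is comonadic, i.e. the comparison from $\mathrm{Caten}(\mathscr X,\mathscr V^{\mathscr G})$ to the 2-category of coalgebras for the induced comonad $\mathrm{Caten}(\mathscr X,\mathscr G)=\mathscr G\circ-$ on $\mathrm{Caten}(\mathscr X,\mathscr V)$ is an equivalence. *)

(* Defs.v *)
From Corelib Require Import ssreflect.
From Stdlib Require Import FunctionalExtensionality ProofIrrelevance.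

Set Implicit Arguments.
Unset Strict Implicit.
Unset Printing Implicit Defensive.
#[local] Obligation Tactic := intros; simpl in *.

Record Category := {
  obj :> Type;
  mor : obj -> obj -> Type;
  idm : forall x, mor x x;
  comp : forall x y z, mor y z -> mor x y -> mor x z;
  comp_idl : forall x y (f : mor x y), comp (idm y) f = f;
  comp_idr : forall x y (f : mor x y), comp f (idm x) = f;
  comp_assoc : forall x y z t (h : mor z t) (g : mor y z) (f : mor x y),
    comp h (comp g f) = comp (comp h g) f
}.
Arguments mor {_} _ _.
Arguments idm {_} _.
Arguments comp {_ _ _ _} _ _.

Notation "x ~> y" := (mor x y) (at level 70, no associativity).
Notation "g ∘ f" := (comp g f) (at level 52, right associativity).

Record Functor (C D : Category) := {
  fobj :> C -> D;
  fmap : forall x y, x ~> y -> fobj x ~> fobj y;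
  fmap_id : forall x, fmap (idm x) = idm (fobj x);
  fmap_comp : forall x y z (g : y ~> z) (f : x ~> y),
    fmap (g ∘ f) = fmap g ∘ fmap f
}.
Arguments fmap {_ _} _ {_ _} _.

Definition Functor_id (C : Category) : Functor C C :=
  {| fobj := fun x => x; fmap := fun _ _ f => f;
     fmap_id := fun _ => eq_refl; fmap_comp := fun _ _ _ _ _ => eq_refl |}.

Lemma Functor_comp_id (C D E : Category) (G : Functor D E) (F : Functor C D) x :
  fmap G (fmap F (idm x)) = idm (G (F x)).
Proof. by rewrite !fmap_id. Qed.

Lemma Functor_comp_comp (C D E : Category) (G : Functor D E) (F : Functor C D)
    x y z (g : y ~> z) (f : x ~> y) :
  fmap G (fmap F (g ∘ f)) = fmap G (fmap F g) ∘ fmap G (fmap F f).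
Proof. by rewrite !fmap_comp. Qed.

Definition Functor_comp (C D E : Category) (G : Functor D E) (F : Functor C D) :
    Functor C E :=
  {| fobj := fun x => G (F x); fmap := fun _ _ f => fmap G (fmap F f);
     fmap_id := Functor_comp_id G F; fmap_comp := Functor_comp_comp G F |}.

(** [tens g f] is the horizontal composite of [g] after [f]. *)
Record Bicat := {
  bob :> Type;
  bhom : bob -> bob -> Category;
  id1 : forall a, bhom a a;
  tens : forall a b c, bhom b c -> bhom a b -> bhom a c;
  htens : forall a b c (g g' : bhom b c) (f f' : bhom a b),
    g ~> g' -> f ~> f' -> tens g f ~> tens g' f';
  htens_id : forall a b c (g : bhom b c) (f : bhom a b),
    htens (idm g) (idm f) = idm (tens g f);
  htens_comp : forall a b c (g g' g'' : bhom b c) (f f' f'' : bhom a b)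
      (q' : g' ~> g'') (q : g ~> g') (p' : f' ~> f'') (p : f ~> f'),
    htens (q' ∘ q) (p' ∘ p) = htens q' p' ∘ htens q p;
  lun : forall a b (f : bhom a b), tens (id1 b) f ~> f;
  lunV : forall a b (f : bhom a b), f ~> tens (id1 b) f;
  lunK : forall a b (f : bhom a b), lunV f ∘ lun f = idm _;
  lunVK : forall a b (f : bhom a b), lun f ∘ lunV f = idm _;
  lun_nat : forall a b (f f' : bhom a b) (p : f ~> f'),
    lun f' ∘ htens (idm _) p = p ∘ lun f;
  run : forall a b (f : bhom a b), tens f (id1 a) ~> f;
  runV : forall a b (f : bhom a b), f ~> tens f (id1 a);
  runK : forall a b (f : bhom a b), runV f ∘ run f = idm _;
  runVK : forall a b (f : bhom a b), run f ∘ runV f = idm _;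
  run_nat : forall a b (f f' : bhom a b) (p : f ~> f'),
    run f' ∘ htens p (idm _) = p ∘ run f;
  ass : forall a b c d (h : bhom c d) (g : bhom b c) (f : bhom a b),
    tens (tens h g) f ~> tens h (tens g f);
  assV : forall a b c d (h : bhom c d) (g : bhom b c) (f : bhom a b),
    tens h (tens g f) ~> tens (tens h g) f;
  assK : forall a b c d (h : bhom c d) (g : bhom b c) (f : bhom a b),
    assV h g f ∘ ass h g f = idm _;
  assVK : forall a b c d (h : bhom c d) (g : bhom b c) (f : bhom a b),
    ass h g f ∘ assV h g f = idm _;
  ass_nat : forall a b c d (h h' : bhom c d) (g g' : bhom b c) (f f' : bhom a b)
      (r : h ~> h') (q : g ~> g') (p : f ~> f'),
    ass h' g' f' ∘ htens (htens r q) p = htens r (htens q p) ∘ ass h g f;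
  triangle : forall a b c (g : bhom b c) (f : bhom a b),
    htens (idm g) (lun f) ∘ ass g (id1 b) f = htens (run g) (idm f);
  pentagon : forall a b c d e
      (k : bhom d e) (h : bhom c d) (g : bhom b c) (f : bhom a b),
    ass k h (tens g f) ∘ ass (tens k h) g f =
    htens (idm k) (ass h g f) ∘ ass k (tens h g) f ∘ htens (ass k h g) (idm f)
}.
Arguments bhom {_} _ _.
Arguments id1 {_} _.
Arguments tens {_ _ _ _} _ _.
Arguments htens {_ _ _ _ _ _ _ _} _ _.
Arguments lun {_ _ _} _.
Arguments lunV {_ _ _} _.
Arguments run {_ _ _} _.
Arguments runV {_ _ _} _.
Arguments ass {_ _ _ _ _} _ _ _.
Arguments assV {_ _ _ _ _} _ _ _.

Notation "g # f" := (tens g f) (at level 46, right associativity).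
Notation "q ## p" := (htens q p) (at level 46, right associativity).

Lemma pre (C : Category) (x y y' z t : C) (g : y ~> z) (f : x ~> y)
    (g' : y' ~> z) (f' : x ~> y') :
  g ∘ f = g' ∘ f' -> forall r : t ~> x, g ∘ f ∘ r = g' ∘ f' ∘ r.
Proof. by move=> e r; rewrite !comp_assoc e. Qed.

Lemma pre1 (C : Category) (x y z t : C) (g : y ~> z) (f : x ~> y) (k : x ~> z) :
  g ∘ f = k -> forall r : t ~> x, g ∘ f ∘ r = k ∘ r.
Proof. by move=> e r; rewrite !comp_assoc e. Qed.

Lemma pre_id (C : Category) (x y t : C) (g : y ~> x) (f : x ~> y) :
  g ∘ f = idm x -> forall r : t ~> x, g ∘ f ∘ r = r.
Proof. by move=> e r; rewrite comp_assoc e comp_idl. Qed.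

Lemma cancel_post (C : Category) (x y z : C) (i : y ~> z) (j : z ~> y)
    (f g : x ~> y) : j ∘ i = idm y -> i ∘ f = i ∘ g -> f = g.
Proof. by move=> e h; rewrite -(comp_idl f) -(comp_idl g) -e -!comp_assoc h. Qed.

Lemma cancel_pre (C : Category) (x y z : C) (i : x ~> y) (j : y ~> x)
    (f g : y ~> z) : i ∘ j = idm y -> f ∘ i = g ∘ i -> f = g.
Proof. by move=> e h; rewrite -(comp_idr f) -(comp_idr g) -e !comp_assoc h. Qed.

Lemma hsplitl (B : Bicat) (a b c : B) (g g' g'' : bhom b c) (f f' : bhom a b)
    (q' : g' ~> g'') (q : g ~> g') (p : f ~> f') :
  (q' ∘ q) ## p = (q' ## p) ∘ (q ## idm f).
Proof. by rewrite -htens_comp comp_idr. Qed.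

Lemma hsplitr (B : Bicat) (a b c : B) (g g' : bhom b c) (f f' f'' : bhom a b)
    (q : g ~> g') (p' : f' ~> f'') (p : f ~> f') :
  q ## (p' ∘ p) = (q ## p') ∘ (idm g ## p).
Proof. by rewrite -htens_comp comp_idr. Qed.

Lemma hl (B : Bicat) (a b c : B) (g g' : bhom b c) (f f' : bhom a b)
    (q : g ~> g') (p : f ~> f') :
  q ## p = (q ## idm f') ∘ (idm g ## p).
Proof. by rewrite -htens_comp comp_idr comp_idl. Qed.

Lemma hr (B : Bicat) (a b c : B) (g g' : bhom b c) (f f' : bhom a b)
    (q : g ~> g') (p : f ~> f') :
  q ## p = (idm g' ## p) ∘ (q ## idm f).
Proof. by rewrite -htens_comp comp_idr comp_idl. Qed.

Lemma lun_faithful (B : Bicat) (a b : B) (f f' : bhom a b) (p q : f ~> f') :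
  idm (id1 b) ## p = idm (id1 b) ## q -> p = q.
Proof.
move=> e; apply: (cancel_pre (lunVK f)).
by rewrite -!lun_nat e.
Qed.

Lemma run_faithful (B : Bicat) (a b : B) (f f' : bhom a b) (p q : f ~> f') :
  p ## idm (id1 a) = q ## idm (id1 a) -> p = q.
Proof.
move=> e; apply: (cancel_pre (runVK f)).
by rewrite -!run_nat e.
Qed.

Lemma htens_iso_r (B : Bicat) (a b c : B) (g : bhom b c) (f f' : bhom a b)
    (p : f ~> f') (q : f' ~> f) :
  q ∘ p = idm _ -> (idm g ## q) ∘ (idm g ## p) = idm _.
Proof. by move=> e; rewrite -htens_comp e comp_idl htens_id. Qed.

Lemma htens_iso_l (B : Bicat) (a b c : B) (g g' : bhom b c) (f : bhom a b)
    (p : g ~> g') (q : g' ~> g) :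
  q ∘ p = idm _ -> (q ## idm f) ∘ (p ## idm f) = idm _.
Proof. by move=> e; rewrite -htens_comp e comp_idl htens_id. Qed.

Lemma lun_tens (B : Bicat) (a b c : B) (g : bhom b c) (f : bhom a b) :
  lun (g # f) ∘ ass (id1 c) g f = lun g ## idm f.
Proof.
apply: lun_faithful.
apply: (cancel_pre (i := ass _ _ _) (j := assV _ _ _)); first exact: assVK.
apply: (cancel_pre (i := ass _ _ _ ## idm f) (j := assV _ _ _ ## idm f)).
  by apply: htens_iso_l; exact: assVK.
rewrite hsplitr -!comp_assoc -pentagon.
rewrite (pre1 (triangle _ _)) -(htens_id g f) -ass_nat.
rewrite (pre (eq_sym (ass_nat _ _ _))).
by rewrite -htens_comp comp_idl triangle.
Qed.

Lemma run_tens (B : Bicat) (a b c : B) (g : bhom b c) (f : bhom a b) :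
  (idm g ## run f) ∘ ass g f (id1 a) = run (g # f).
Proof.
apply: run_faithful.
apply: (cancel_post (i := ass _ _ _) (j := assV _ _ _)); first exact: assK.
rewrite hsplitl (pre (ass_nat _ _ _)).
rewrite -triangle hsplitr -!comp_assoc -pentagon.
by rewrite -(pre (ass_nat _ _ _)) htens_id triangle.
Qed.

Lemma lun_run_id (B : Bicat) (a : B) : lun (id1 a) = run (id1 a).
Proof.
apply: run_faithful.
rewrite -triangle -lun_tens; congr (_ ∘ _).
apply: (cancel_post (i := lun _) (j := lunV _)); first exact: lunK.
by rewrite lun_nat.
Qed.

(** A morphism [A : W -> V] is indexed by its boundary: [tob A w v] is the set
    of the objects [a] of [A] with [a_- = w] and [a_+ = v], so that the span
    [Ob W <- Ob A -> Ob V] is the total space of the family [tob A]. *)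
Record TwoSided (W V : Bicat) := {
  tob : W -> V -> Type;
  tfun : forall w v w' v', tob w v -> tob w' v' ->
    Functor (bhom w w') (bhom v v');
  teta : forall w v (a : tob w v), id1 v ~> tfun a a (id1 w);
  tmu : forall w v w' v' w'' v''
      (a : tob w v) (a' : tob w' v') (a'' : tob w'' v'')
      (x' : bhom w' w'') (x : bhom w w'),
    tfun a' a'' x' # tfun a a' x ~> tfun a a'' (x' # x);
  tmu_nat : forall w v w' v' w'' v''
      (a : tob w v) (a' : tob w' v') (a'' : tob w'' v'')
      (x' y' : bhom w' w'') (x y : bhom w w') (q : x' ~> y') (p : x ~> y),
    tmu a a' a'' y' y ∘ (fmap (tfun a' a'') q ## fmap (tfun a a') p) =
    fmap (tfun a a'') (q ## p) ∘ tmu a a' a'' x' x;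
  tmu_ass : forall w v w' v' w'' v'' w''' v'''
      (a : tob w v) (a' : tob w' v') (a'' : tob w'' v'') (a''' : tob w''' v''')
      (x'' : bhom w'' w''') (x' : bhom w' w'') (x : bhom w w'),
    fmap (tfun a a''') (ass x'' x' x) ∘ tmu a a' a''' (x'' # x') x ∘
      (tmu a' a'' a''' x'' x' ## idm (tfun a a' x)) =
    tmu a a'' a''' x'' (x' # x) ∘
      (idm (tfun a'' a''' x'') ## tmu a a' a'' x' x) ∘
      ass (tfun a'' a''' x'') (tfun a' a'' x') (tfun a a' x);
  tmu_lun : forall w v w' v' (a : tob w v) (a' : tob w' v') (x : bhom w w'),
    fmap (tfun a a') (lun x) ∘ tmu a a' a' (id1 w') x ∘
      (teta a' ## idm (tfun a a' x)) = lun (tfun a a' x);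
  tmu_run : forall w v w' v' (a : tob w v) (a' : tob w' v') (x : bhom w w'),
    fmap (tfun a a') (run x) ∘ tmu a a a' x (id1 w) ∘
      (idm (tfun a a' x) ## teta a) = run (tfun a a' x)
}.
Arguments tob {_ _} _ _ _.
Arguments tfun {_ _} _ {_ _ _ _} _ _.
Arguments teta {_ _} _ {_ _} _.
Arguments tmu {_ _} _ {_ _ _ _ _ _} _ _ _ _ _.

(** Families indexed by their boundary make [(FA)_± = A_±] part of the typing. *)
Record EFun (W V : Bicat) (A B : TwoSided W V) := {
  eob : forall w v, tob A w v -> tob B w v;
  ecell : forall w v w' v' (a : tob A w v) (a' : tob A w' v') (x : bhom w w'),
    tfun A a a' x ~> tfun B (eob a) (eob a') x;
  ecell_nat : forall w v w' v' (a : tob A w v) (a' : tob A w' v')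
      (x y : bhom w w') (p : x ~> y),
    ecell a a' y ∘ fmap (tfun A a a') p =
    fmap (tfun B (eob a) (eob a')) p ∘ ecell a a' x;
  ecell_mu : forall w v w' v' w'' v''
      (a : tob A w v) (a' : tob A w' v') (a'' : tob A w'' v'')
      (x' : bhom w' w'') (x : bhom w w'),
    ecell a a'' (x' # x) ∘ tmu A a a' a'' x' x =
    tmu B (eob a) (eob a') (eob a'') x' x ∘ (ecell a' a'' x' ## ecell a a' x);
  ecell_eta : forall w v (a : tob A w v),
    ecell a a (id1 w) ∘ teta A a = teta B (eob a)
}.
Arguments eob {_ _ _ _} _ {_ _} _.
Arguments ecell {_ _ _ _} _ {_ _ _ _} _ _ _.

(** [actl p f] is [mu ∘ (p ⊗ f)] and [actr f p] is [mu ∘ (f ⊗ p)], with the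
    identification of [1 ⊗ s] and [s ⊗ 1] with [s] (and of [1 ⊗ x] and [x ⊗ 1]
    with [x]) made explicit. *)
Definition actl (W V : Bicat) (B : TwoSided W V) w v w' v'
    (a : tob B w v) (b b' : tob B w' v') (x : bhom w w') (s : bhom v v')
    (p : id1 v' ~> tfun B b b' (id1 w')) (f : s ~> tfun B a b x) :
    s ~> tfun B a b' x :=
  fmap (tfun B a b') (lun x) ∘ tmu B a b b' (id1 w') x ∘ (p ## f) ∘ lunV s.

Definition actr (W V : Bicat) (B : TwoSided W V) w v w' v'
    (a a' : tob B w v) (b : tob B w' v') (x : bhom w w') (s : bhom v v')
    (f : s ~> tfun B a' b x) (p : id1 v ~> tfun B a a' (id1 w)) :
    s ~> tfun B a b x :=
  fmap (tfun B a b) (run x) ∘ tmu B a a' b x (id1 w) ∘ (f ## p) ∘ runV s.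

Record Tricell (W V : Bicat) (A B : TwoSided W V) (F E : EFun A B) := {
  tcell :> forall w v (a : tob A w v),
    id1 v ~> tfun B (eob F a) (eob E a) (id1 w);
  tcell_nat : forall w v w' v' (a : tob A w v) (a' : tob A w' v')
      (x : bhom w w'),
    actl (tcell a') (ecell F a a' x) = actr (ecell E a a' x) (tcell a)
}.
Arguments tcell {_ _ _ _ _ _} _ {_ _} _.

Lemma lunV_nat (B : Bicat) (a b : B) (f f' : bhom a b) (p : f ~> f') :
  (idm _ ## p) ∘ lunV f = lunV f' ∘ p.
Proof.
apply: (cancel_post (i := lun _) (j := lunV _)); first exact: lunK.
by rewrite (pre (lun_nat p)) lunVK comp_idr comp_assoc lunVK comp_idl.
Qed.

Lemma runV_nat (B : Bicat) (a b : B) (f f' : bhom a b) (p : f ~> f') :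
  (p ## idm _) ∘ runV f = runV f' ∘ p.
Proof.
apply: (cancel_post (i := run _) (j := runV _)); first exact: runK.
by rewrite (pre (run_nat p)) runVK comp_idr comp_assoc runVK comp_idl.
Qed.

Lemma inv_eq (C : Category) (x y : C) (i i' : x ~> y) (j j' : y ~> x) :
  i = i' -> i ∘ j = idm y -> j' ∘ i' = idm x -> j = j'.
Proof.
move=> e h h'.
by rewrite -(comp_idr j') -h comp_assoc e h' comp_idl.
Qed.

Lemma coh_inv (B : Bicat) (a b c d : B) (h : bhom c d) (g : bhom b c)
    (f : bhom a b) (y : bhom a d) (y1 : bhom a c) (y2 : bhom b d)
    (i : h # y1 ~> y) (i1 : g # f ~> y1) (j : y2 # f ~> y) (j1 : h # g ~> y2)
    (k : y ~> h # y1) (k1 : y1 ~> g # f) (l : y ~> y2 # f) (l1 : y2 ~> h # g) :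
  i ∘ (idm h ## i1) ∘ ass h g f = j ∘ (j1 ## idm f) ->
  k ∘ i = idm _ -> i ∘ k = idm _ -> k1 ∘ i1 = idm _ -> i1 ∘ k1 = idm _ ->
  j ∘ l = idm _ -> j1 ∘ l1 = idm _ ->
  (idm h ## k1) ∘ k = ass h g f ∘ (l1 ## idm f) ∘ l.
Proof.
move=> e ki ik k1i1 i1k1 jl j1l1.
apply: (cancel_post (i := i ∘ (idm h ## i1)) (j := (idm h ## k1) ∘ k)).
  by rewrite -comp_assoc (pre_id ki) -htens_comp k1i1 comp_idl htens_id.
rewrite -!comp_assoc (pre_id (htens_iso_r h i1k1)) ik.
have h3 : forall q (r : q ~> _), i ∘ (idm h ## i1) ∘ ass h g f ∘ r =
    j ∘ (j1 ## idm f) ∘ r.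
  by move=> q r; rewrite !comp_assoc -(comp_assoc i) e.
by rewrite h3 (pre_id (htens_iso_l f j1l1)) jl.
Qed.

Section Actions.
Context (W V : Bicat) (B : TwoSided W V).

Lemma actl_eta w v w' v' (a : tob B w v) (b : tob B w' v') (x : bhom w w')
    (s : bhom v v') (f : s ~> tfun B a b x) : actl (teta B b) f = f.
Proof.
rewrite /actl (hl (teta B b)) -!comp_assoc lunV_nat.
have -> : forall r : s ~> id1 v' # tfun B a b x, fmap (tfun B a b) (lun x) ∘
   tmu B a b b (id1 w') x ∘ (teta B b ## idm _) ∘ r = lun _ ∘ r.
  by move=> *; rewrite -(tmu_lun a b x) -!comp_assoc.
by rewrite comp_assoc lunVK comp_idl.
Qed.

Lemma actr_eta w v w' v' (a : tob B w v) (b : tob B w' v') (x : bhom w w')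
    (s : bhom v v') (f : s ~> tfun B a b x) : actr f (teta B a) = f.
Proof.
rewrite /actr (hr f) -!comp_assoc runV_nat.
have -> : forall r : s ~> tfun B a b x # id1 v, fmap (tfun B a b) (run x) ∘
   tmu B a a b x (id1 w) ∘ (idm _ ## teta B a) ∘ r = run _ ∘ r.
  by move=> *; rewrite -(tmu_run a b x) -!comp_assoc.
by rewrite comp_assoc runVK comp_idl.
Qed.

Lemma actl_pre w v w' v' (a : tob B w v) (b b' : tob B w' v') (x : bhom w w')
    (s s' : bhom v v') (p : id1 v' ~> tfun B b b' (id1 w'))
    (f : s ~> tfun B a b x) (r : s' ~> s) :
  actl p (f ∘ r) = actl p f ∘ r.
Proof. by rewrite /actl -!comp_assoc hsplitr -comp_assoc lunV_nat. Qed.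

Lemma actr_pre w v w' v' (a a' : tob B w v) (b : tob B w' v') (x : bhom w w')
    (s s' : bhom v v') (p : id1 v ~> tfun B a a' (id1 w))
    (f : s ~> tfun B a' b x) (r : s' ~> s) :
  actr (f ∘ r) p = actr f p ∘ r.
Proof. by rewrite /actr -!comp_assoc hsplitl -comp_assoc runV_nat. Qed.

Lemma actlr w v (a b c : tob B w v)
    (p : id1 v ~> tfun B b c (id1 w)) (f : id1 v ~> tfun B a b (id1 w)) :
  actl p f = actr p f.
Proof.
rewrite /actl /actr lun_run_id.
by rewrite (inv_eq (lun_run_id v) (lunVK _) (runK _)).
Qed.

Lemma tmu3 w v w' v' w'' v'' w3 v3
    (a : tob B w v) (a' : tob B w' v') (a'' : tob B w'' v'') (a3 : tob B w3 v3)
    (x'' : bhom w'' w3) (x' : bhom w' w'') (x : bhom w w')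
    (s'' : bhom v'' v3) (s' : bhom v' v'') (s : bhom v v')
    (f'' : s'' ~> tfun B a'' a3 x'') (f' : s' ~> tfun B a' a'' x')
    (f : s ~> tfun B a a' x) :
  tmu B a a'' a3 x'' (x' # x) ∘ (f'' ## (tmu B a a' a'' x' x ∘ (f' ## f))) ∘
    ass s'' s' s =
  fmap (tfun B a a3) (ass x'' x' x) ∘ tmu B a a' a3 (x'' # x') x ∘
    ((tmu B a' a'' a3 x'' x' ∘ (f'' ## f')) ## f).
Proof.
rewrite -{1}(comp_idl f'') htens_comp -!comp_assoc -ass_nat.
rewrite -{2}(comp_idl f) htens_comp !comp_assoc.
by rewrite -(comp_assoc (fmap _ _)) tmu_ass !comp_assoc.
Qed.

(* Both sides of an associativity law for the actions have the form of the two
   sides below; the hypotheses are instances of coherence in [W] and [V]. *)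
Lemma act3 w v w' v' w'' v'' w3 v3
    (a : tob B w v) (a' : tob B w' v') (a'' : tob B w'' v'') (a3 : tob B w3 v3)
    (x'' : bhom w'' w3) (x' : bhom w' w'') (x : bhom w w')
    (s'' : bhom v'' v3) (s' : bhom v' v'') (s : bhom v v')
    (f'' : s'' ~> tfun B a'' a3 x'') (f' : s' ~> tfun B a' a'' x')
    (f : s ~> tfun B a a' x)
    (y : bhom w w3) (y1 : bhom w w'') (y2 : bhom w' w3)
    (t : bhom v v3) (t1 : bhom v v'') (t2 : bhom v' v3)
    (i : x'' # y1 ~> y) (i1 : x' # x ~> y1)
    (j : y2 # x ~> y) (j1 : x'' # x' ~> y2)
    (k : t ~> s'' # t1) (k1 : t1 ~> s' # s)
    (l : t ~> t2 # s) (l1 : t2 ~> s'' # s') :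
  i ∘ (idm x'' ## i1) ∘ ass x'' x' x = j ∘ (j1 ## idm x) ->
  (idm s'' ## k1) ∘ k = ass s'' s' s ∘ (l1 ## idm s) ∘ l ->
  fmap (tfun B a a3) i ∘ tmu B a a'' a3 x'' y1 ∘
    (f'' ## (fmap (tfun B a a'') i1 ∘ tmu B a a' a'' x' x ∘ (f' ## f) ∘ k1)) ∘ k =
  fmap (tfun B a a3) j ∘ tmu B a a' a3 y2 x ∘
    ((fmap (tfun B a' a3) j1 ∘ tmu B a' a'' a3 x'' x' ∘ (f'' ## f') ∘ l1) ## f) ∘ l.
Proof.
move=> e e'.
set g := tmu B a a' a'' x' x ∘ (f' ## f).
set g' := tmu B a' a'' a3 x'' x' ∘ (f'' ## f').
have h : forall q (r : q ~> _), tmu B a a'' a3 x'' y1 ∘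
    (f'' ## (fmap (tfun B a a'') i1 ∘ r)) =
    fmap (tfun B a a3) (idm x'' ## i1) ∘ tmu B a a'' a3 x'' (x' # x) ∘ (f'' ## r).
  move=> q r; rewrite -{1}(comp_idl f'') -{1}(fmap_id (tfun B a'' a3)) htens_comp.
  by rewrite (pre (tmu_nat _ _ _ _ _)).
have h' : forall q (r : q ~> _), tmu B a a' a3 y2 x ∘
    ((fmap (tfun B a' a3) j1 ∘ r) ## f) =
    fmap (tfun B a a3) (j1 ## idm x) ∘ tmu B a a' a3 (x'' # x') x ∘ (r ## f).
  move=> q r; rewrite -{1}(comp_idl f) -{1}(fmap_id (tfun B a a')) htens_comp.
  by rewrite (pre (tmu_nat _ _ _ _ _)).
have -> : fmap (tfun B a a'') i1 ∘ tmu B a a' a'' x' x ∘ (f' ## f) ∘ k1 =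
   fmap (tfun B a a'') i1 ∘ (g ∘ k1) by rewrite /g -!comp_assoc.
have -> : fmap (tfun B a' a3) j1 ∘ tmu B a' a'' a3 x'' x' ∘ (f'' ## f') ∘ l1 =
   fmap (tfun B a' a3) j1 ∘ (g' ∘ l1) by rewrite /g' -!comp_assoc.
have h3 : forall q (r : q ~> _),
    tmu B a a'' a3 x'' (x' # x) ∘ (f'' ## g) ∘ ass s'' s' s ∘ r =
    fmap (tfun B a a3) (ass x'' x' x) ∘ tmu B a a' a3 (x'' # x') x ∘
      (g' ## f) ∘ r.
  by move=> q r; rewrite !comp_assoc -(comp_assoc (tmu _ _ _ _ _ _)) tmu3 !comp_assoc.
rewrite (pre1 (h _ _)) (pre1 (h' _ _)) hsplitr hsplitl -!comp_assoc e' h3.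
rewrite (comp_assoc (fmap _ (_ ## _)) (fmap _ _)) -fmap_comp.
by rewrite (comp_assoc (fmap _ i)) -fmap_comp e [in RHS]comp_assoc -fmap_comp.
Qed.

Lemma actl_actl w v w' v' (a : tob B w v) (b b' b'' : tob B w' v')
    (x : bhom w w') (s : bhom v v') (q : id1 v' ~> tfun B b' b'' (id1 w'))
    (p : id1 v' ~> tfun B b b' (id1 w')) (f : s ~> tfun B a b x) :
  actl q (actl p f) = actl (actl q p) f.
Proof.
have h (C : Bicat) (d e : C) (y : bhom d e) :
    lun y ∘ (idm _ ## lun y) ∘ ass _ _ y = lun y ∘ (lun _ ## idm y).
  by rewrite (pre (lun_nat _)) lun_tens.
apply: act3; first exact: h.
apply: (coh_inv (h _ _ _ _)); by [exact: lunK|exact: lunVK].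
Qed.

Lemma actr_actr w v w' v' (a a' a'' : tob B w v) (b : tob B w' v')
    (x : bhom w w') (s : bhom v v') (f : s ~> tfun B a'' b x)
    (q : id1 v ~> tfun B a' a'' (id1 w)) (p : id1 v ~> tfun B a a' (id1 w)) :
  actr f (actl q p) = actr (actr f q) p.
Proof.
rewrite actlr.
have h (C : Bicat) (d e : C) (y : bhom d e) :
    run y ∘ (idm _ ## run _) ∘ ass y _ _ = run y ∘ (run y ## idm _).
  by rewrite run_tens run_nat.
apply: act3; first exact: h.
apply: (coh_inv (h _ _ _ _)); by [exact: runK|exact: runVK].
Qed.

Lemma actl_actr w v w' v' (a a' : tob B w v) (b b' : tob B w' v')
    (x : bhom w w') (s : bhom v v') (q : id1 v' ~> tfun B b b' (id1 w'))
    (f : s ~> tfun B a' b x) (p : id1 v ~> tfun B a a' (id1 w)) :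
  actl q (actr f p) = actr (actl q f) p.
Proof.
have h (C : Bicat) (d e : C) (y : bhom d e) :
    lun y ∘ (idm _ ## run _) ∘ ass _ y _ = run y ∘ (lun y ## idm _).
  by rewrite (pre (lun_nat _)) lun_tens run_nat.
apply: act3; first exact: h.
apply: (coh_inv (h _ _ _ _));
  by [exact: runK|exact: runVK|exact: lunK|exact: lunVK].
Qed.
End Actions.

(** Equality of the arrows of a category as such: sources and targets are
    compared as well, so that 2-cells whose boundaries are only propositionally
    equal can be compared. *)
Definition arr (C : Category) (x y : C) (f : x ~> y) : {xy : C * C & fst xy ~> snd xy} :=
  existT (fun xy : C * C => fst xy ~> snd xy) (x, y) f.

Record TwoCat := {
  c0 :> Type;
  c1 : c0 -> c0 -> Category;
  cid : forall a, c1 a a;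
  ccomp : forall a b c, c1 b c -> c1 a b -> c1 a c;
  hcomp : forall a b c (g g' : c1 b c) (f f' : c1 a b),
    g ~> g' -> f ~> f' -> ccomp g f ~> ccomp g' f';
  hcomp_id : forall a b c (g : c1 b c) (f : c1 a b),
    hcomp (idm g) (idm f) = idm (ccomp g f);
  hcomp_comp : forall a b c (g g' g'' : c1 b c) (f f' f'' : c1 a b)
      (q' : g' ~> g'') (q : g ~> g') (p' : f' ~> f'') (p : f ~> f'),
    hcomp (q' ∘ q) (p' ∘ p) = hcomp q' p' ∘ hcomp q p;
  ccomp_idl : forall a b (f : c1 a b), ccomp (cid b) f = f;
  ccomp_idr : forall a b (f : c1 a b), ccomp f (cid a) = f;
  ccomp_assoc : forall a b c d (h : c1 c d) (g : c1 b c) (f : c1 a b),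
    ccomp h (ccomp g f) = ccomp (ccomp h g) f;
  hcomp_idl : forall a b (f f' : c1 a b) (p : f ~> f'),
    arr (hcomp (idm (cid b)) p) = arr p;
  hcomp_idr : forall a b (f f' : c1 a b) (p : f ~> f'),
    arr (hcomp p (idm (cid a))) = arr p;
  hcomp_assoc : forall a b c d (h h' : c1 c d) (g g' : c1 b c) (f f' : c1 a b)
      (r : h ~> h') (q : g ~> g') (p : f ~> f'),
    arr (hcomp r (hcomp q p)) = arr (hcomp (hcomp r q) p)
}.
Arguments c1 {_} _ _.
Arguments cid {_} _.
Arguments ccomp {_ _ _ _} _ _.
Arguments hcomp {_ _ _ _ _ _ _ _} _ _.

Notation "g • f" := (ccomp g f) (at level 48, right associativity).
Notation "q ★ p" := (hcomp q p) (at level 48, right associativity).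

Record TwoFunctor (K L : TwoCat) := {
  F0 :> K -> L;
  F1 : forall a b, Functor (c1 a b) (c1 (F0 a) (F0 b));
  F1_id : forall a, F1 a a (cid a) = cid (F0 a);
  F1_comp : forall a b c (g : c1 b c) (f : c1 a b),
    F1 a c (g • f) = F1 b c g • F1 a b f;
  F2_comp : forall a b c (g g' : c1 b c) (f f' : c1 a b)
      (q : g ~> g') (p : f ~> f'),
    arr (fmap (F1 a c) (q ★ p)) = arr (fmap (F1 b c) q ★ fmap (F1 a b) p)
}.
Arguments F1 {_ _} _ {_ _}.

Definition F2 (K L : TwoCat) (T : TwoFunctor K L) (a b : K) (f f' : c1 a b)
  (p : f ~> f') : F1 T f ~> F1 T f' := fmap (F1 T) p.

Record TwoNat (K L : TwoCat) (S T : TwoFunctor K L) := {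
  n0 :> forall a, c1 (S a) (T a);
  n1 : forall a b (f : c1 a b), F1 T f • n0 a = n0 b • F1 S f;
  n2 : forall a b (f f' : c1 a b) (p : f ~> f'),
    arr (F2 T p ★ idm (n0 a)) = arr (idm (n0 b) ★ F2 S p)
}.

Lemma arr_inj (C : Category) (x y : C) (f g : x ~> y) : arr f = arr g -> f = g.
Proof. exact: inj_pair2. Qed.

Lemma arr_id (C : Category) (x y : C) : x = y -> arr (idm x) = arr (idm y).
Proof. by move=> ->. Qed.

Lemma arr_bd (C : Category) (x y x' y' : C) (f : x ~> y) (g : x' ~> y') :
  arr f = arr g -> x = x' /\ y = y'.
Proof. by move=> e; have := f_equal (@projT1 _ _) e => -[-> ->]. Qed.

Lemma arr_comp (C : Category) (x y z x' y' z' : C) (g : y ~> z) (f : x ~> y)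
    (g' : y' ~> z') (f' : x' ~> y') :
  arr g = arr g' -> arr f = arr f' -> arr (g ∘ f) = arr (g' ∘ f').
Proof.
move=> eg ef; case: (arr_bd eg) (arr_bd ef) => ? ? [? ?]; subst.
by rewrite (arr_inj eg) (arr_inj ef).
Qed.

Lemma arr_hcomp (K : TwoCat) (a b c : K) (g g' k k' : c1 b c) (f f' h h' : c1 a b)
    (q : g ~> g') (r : k ~> k') (p : f ~> f') (s : h ~> h') :
  arr q = arr r -> arr p = arr s -> arr (q ★ p) = arr (r ★ s).
Proof.
move=> eg ef; case: (arr_bd eg) (arr_bd ef) => ? ? [? ?]; subst.
by rewrite (arr_inj eg) (arr_inj ef).
Qed.

Lemma arr_F2 (K L : TwoCat) (T : TwoFunctor K L) (a b : K) (f f' h h' : c1 a b)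
    (p : f ~> f') (s : h ~> h') :
  arr p = arr s -> arr (F2 T p) = arr (F2 T s).
Proof. by move=> ef; case: (arr_bd ef) => ? ?; subst; rewrite (arr_inj ef). Qed.

Definition TwoFunctor_id (K : TwoCat) : TwoFunctor K K :=
  {| F0 := fun a => a; F1 := fun a b => Functor_id (c1 a b);
     F1_id := fun _ => eq_refl; F1_comp := fun _ _ _ _ _ => eq_refl;
     F2_comp := fun _ _ _ _ _ _ _ _ _ => eq_refl |}.

Program Definition TwoFunctor_comp (K L M : TwoCat) (T : TwoFunctor L M)
    (S : TwoFunctor K L) : TwoFunctor K M :=
  {| F0 := fun a => T (S a); F1 := fun a b => Functor_comp (F1 T) (F1 S) |}.
Next Obligation. by rewrite /= !F1_id. Qed.
Next Obligation. by rewrite /= !F1_comp. Qed.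
Next Obligation.
by rewrite -F2_comp; apply: arr_F2; apply: F2_comp.
Qed.

(** An equivalence of 2-categories is an equivalence of [Cat]-enriched
    categories: a 2-functor with an inverse up to 2-natural isomorphisms. *)
Definition is_iso1 (K : TwoCat) (a b : K) (f : c1 a b) : Prop :=
  exists g : c1 b a, g • f = cid a /\ f • g = cid b.

Definition is_2equivalence (K L : TwoCat) (T : TwoFunctor K L) : Prop :=
  exists (S : TwoFunctor L K)
         (i : TwoNat (TwoFunctor_id K) (TwoFunctor_comp S T))
         (j : TwoNat (TwoFunctor_comp T S) (TwoFunctor_id L)),
    (forall a, is_iso1 (i a)) /\ (forall b, is_iso1 (j b)).

Record TwoComonad (K : TwoCat) := {
  cmT :> TwoFunctor K K;
  cme : TwoNat cmT (TwoFunctor_id K);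
  cmd : TwoNat cmT (TwoFunctor_comp cmT cmT);
  cm_counit_l : forall a, cme (cmT a) • cmd a = cid (cmT a);
  cm_counit_r : forall a, F1 cmT (cme a) • cmd a = cid (cmT a);
  cm_coassoc : forall a, cmd (cmT a) • cmd a = F1 cmT (cmd a) • cmd a
}.
Arguments cme {_} _.
Arguments cmd {_} _.

Section Coalgebras.
Context (K : TwoCat) (T : TwoComonad K).

Record Coalg := {
  co_ob :> K;
  co_act : c1 co_ob (T co_ob);
  co_counit : cme T co_ob • co_act = cid co_ob;
  co_coassoc : cmd T co_ob • co_act = F1 T co_act • co_act
}.

Record CoalgMor (a b : Coalg) := {
  cm_mor :> c1 a b;
  cm_sq : F1 T cm_mor • co_act a = co_act b • cm_mor
}.

Record CoalgCell (a b : Coalg) (f g : CoalgMor a b) := {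
  cc_cell :> cm_mor f ~> cm_mor g;
  cc_sq : arr (F2 T cc_cell ★ idm (co_act a)) = arr (idm (co_act b) ★ cc_cell)
}.

Lemma CoalgMor_eq a b (f g : CoalgMor a b) : cm_mor f = cm_mor g -> f = g.
Proof.
case: f g => f e [g e'] /= h; subst g.
by rewrite (proof_irrelevance _ e e').
Qed.

Lemma CoalgCell_eq a b (f g : CoalgMor a b) (p q : CoalgCell f g) :
  cc_cell p = cc_cell q -> p = q.
Proof.
case: p q => f' e [g' e'] /= h; subst g'.
by rewrite (proof_irrelevance _ e e').
Qed.

Program Definition CoalgHom (a b : Coalg) : Category :=
  {| obj := CoalgMor a b; mor := @CoalgCell a b;
     idm := fun f => {| cc_cell := idm (cm_mor f) |};
     comp := fun f g h q p => {| cc_cell := cc_cell q ∘ cc_cell p |} |}.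
Next Obligation.
rewrite /F2 fmap_id !hcomp_id; apply: arr_id; exact: cm_sq.
Qed.
Next Obligation.
rewrite /F2 fmap_comp -(comp_idl (idm (co_act a))) hcomp_comp.
rewrite -(comp_idl (idm (co_act b))) hcomp_comp.
by apply: arr_comp; apply: cc_sq.
Qed.
Next Obligation. apply: CoalgCell_eq; exact: comp_idl. Qed.
Next Obligation. apply: CoalgCell_eq; exact: comp_idr. Qed.
Next Obligation. apply: CoalgCell_eq; exact: comp_assoc. Qed.

Program Definition CoalgMor_id (a : Coalg) : CoalgMor a a :=
  {| cm_mor := cid a |}.
Next Obligation. by rewrite F1_id ccomp_idl ccomp_idr. Qed.

Program Definition CoalgMor_comp (a b c : Coalg) (g : CoalgMor b c)
  (f : CoalgMor a b) : CoalgMor a c := {| cm_mor := cm_mor g • cm_mor f |}.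
Next Obligation.
by rewrite F1_comp -ccomp_assoc cm_sq ccomp_assoc cm_sq ccomp_assoc.
Qed.

Program Definition CoalgCell_hcomp (a b c : Coalg) (g g' : CoalgHom b c)
    (f f' : CoalgHom a b) (q : g ~> g') (p : f ~> f') :
    CoalgCell (CoalgMor_comp g f) (CoalgMor_comp g' f') :=
  {| cc_cell := cc_cell q ★ cc_cell p |}.
Next Obligation.
transitivity (arr ((F2 T q ★ F2 T p) ★ idm (co_act a))).
  by apply: arr_hcomp => //; apply: F2_comp.
rewrite -hcomp_assoc.
transitivity (arr (F2 T q ★ (idm (co_act b) ★ p))).
  by apply: arr_hcomp => //; apply: cc_sq.
rewrite !hcomp_assoc.
by apply: arr_hcomp => //; apply: cc_sq.
Qed.

Lemma arr_Coalg (a b : Coalg) (f g f' g' : CoalgHom a b) (p : f ~> g)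
    (p' : f' ~> g') :
  arr (cc_cell p) = arr (cc_cell p') -> arr p = arr p'.
Proof.
move=> e; case: (arr_bd e) => /CoalgMor_eq e1 /CoalgMor_eq e2; subst f' g'.
by congr arr; apply: CoalgCell_eq; apply: arr_inj.
Qed.

(** Strict coalgebras, strict morphisms, and compatible 2-cells. *)
Program Definition CoalgTwoCat : TwoCat :=
  {| c0 := Coalg; c1 := CoalgHom; cid := CoalgMor_id;
     ccomp := CoalgMor_comp; hcomp := CoalgCell_hcomp |}.
Next Obligation. apply: CoalgCell_eq; exact: hcomp_id. Qed.
Next Obligation. apply: CoalgCell_eq; exact: hcomp_comp. Qed.
Next Obligation. apply: CoalgMor_eq; exact: ccomp_idl. Qed.
Next Obligation. apply: CoalgMor_eq; exact: ccomp_idr. Qed.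
Next Obligation. apply: CoalgMor_eq; exact: ccomp_assoc. Qed.
Next Obligation. apply: arr_Coalg; exact: hcomp_idl. Qed.
Next Obligation. apply: arr_Coalg; exact: hcomp_idr. Qed.
Next Obligation. apply: arr_Coalg; exact: hcomp_assoc. Qed.

(** A coaction of [T] on a 2-functor [S] into [K] lifts [S] to coalgebras. *)
Record Coaction (J : TwoCat) (S : TwoFunctor J K) := {
  ca_nat :> TwoNat S (TwoFunctor_comp T S);
  ca_counit : forall a, cme T (S a) • ca_nat a = cid (S a);
  ca_coassoc : forall a, cmd T (S a) • ca_nat a = F1 T (ca_nat a) • ca_nat a
}.

Section Comparison.
Context (J : TwoCat) (S : TwoFunctor J K) (k : Coaction S).

Definition comparison0 (a : J) : Coalg :=
  {| co_ob := S a; co_act := k a; co_counit := ca_counit k a;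
     co_coassoc := ca_coassoc k a |}.

Definition comparison1 (a b : J) (f : c1 a b) :
    CoalgMor (comparison0 a) (comparison0 b) :=
  {| cm_mor := F1 S f : c1 (comparison0 a : K) (comparison0 b); cm_sq := n1 k f |}.

Definition comparison2 (a b : J) (f g : c1 a b) (p : f ~> g) :
    CoalgCell (comparison1 f) (comparison1 g) :=
  {| cc_cell := F2 S p : cm_mor (comparison1 f) ~> comparison1 g;
     cc_sq := n2 k p |}.

Program Definition comparison : TwoFunctor J CoalgTwoCat :=
  {| F0 := comparison0 : J -> CoalgTwoCat;
     F1 := fun a b =>
       {| fobj := @comparison1 a b : c1 a b -> CoalgHom _ _;
          fmap := @comparison2 a b |} |}.
Next Obligation. apply: CoalgCell_eq; exact: fmap_id. Qed.
Next Obligation. apply: CoalgCell_eq; exact: fmap_comp. Qed.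
Next Obligation. apply: CoalgMor_eq; exact: F1_id. Qed.
Next Obligation. apply: CoalgMor_eq; exact: F1_comp. Qed.
Next Obligation. apply: arr_Coalg; exact: F2_comp. Qed.
End Comparison.
End Coalgebras.

Program Definition EFun_id (W V : Bicat) (A : TwoSided W V) : EFun A A :=
  {| eob := fun _ _ a => a; ecell := fun _ _ _ _ a a' x => idm (tfun A a a' x) |}.
Next Obligation. by rewrite comp_idl comp_idr. Qed.
Next Obligation. by rewrite htens_id comp_idl comp_idr. Qed.
Next Obligation. by rewrite comp_idl. Qed.

Program Definition EFun_comp (W V : Bicat) (A B C : TwoSided W V)
    (G : EFun B C) (F : EFun A B) : EFun A C :=
  {| eob := fun _ _ a => eob G (eob F a);
     ecell := fun _ _ _ _ a a' x =>
       ecell G (eob F a) (eob F a') x ∘ ecell F a a' x |}.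
Next Obligation. by rewrite -comp_assoc ecell_nat comp_assoc ecell_nat comp_assoc. Qed.
Next Obligation.
by rewrite -comp_assoc ecell_mu comp_assoc ecell_mu htens_comp comp_assoc.
Qed.
Next Obligation. by rewrite -comp_assoc !ecell_eta. Qed.

Definition ecell_sig (W V : Bicat) (A B : TwoSided W V) (F : EFun A B)
    w v w' v' (a : tob A w v) (a' : tob A w' v') (x : bhom w w') :=
  existT (fun p : tob B w v * tob B w' v' =>
            tfun A a a' x ~> tfun B (fst p) (snd p) x)
    (eob F a, eob F a') (ecell F a a' x).

Lemma EFun_ext (W V : Bicat) (A B : TwoSided W V) (F E : EFun A B) :
  (forall w v w' v' (a : tob A w v) (a' : tob A w' v') (x : bhom w w'),
     ecell_sig F a a' x = ecell_sig E a a' x) -> F = E.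
Proof.
case: F => o c n m t; case: E => o' c' n' m' t' h.
have e : o = o'.
  apply: functional_extensionality_dep => w.
  apply: functional_extensionality_dep => v.
  apply: functional_extensionality_dep => a.
  exact: (f_equal (fun s => fst (projT1 s)) (h w v w v a a (id1 w))).
subst o'.
have e : c = c'.
  do 7 apply: functional_extensionality_dep => ?.
  exact: (inj_pair2 _ _ _ _ _ (h _ _ _ _ _ _ _)).
subst c'.
by congr Build_EFun; apply: proof_irrelevance.
Qed.

Lemma EFun_comp_idl (W V : Bicat) (A B : TwoSided W V) (F : EFun A B) :
  EFun_comp (EFun_id B) F = F.
Proof. by apply: EFun_ext => *; rewrite /ecell_sig /= comp_idl. Qed.

Lemma EFun_comp_idr (W V : Bicat) (A B : TwoSided W V) (F : EFun A B) :
  EFun_comp F (EFun_id A) = F.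
Proof. by apply: EFun_ext => *; rewrite /ecell_sig /= comp_idr. Qed.

Lemma EFun_comp_assoc (W V : Bicat) (A B C D : TwoSided W V) (H : EFun C D)
    (G : EFun B C) (F : EFun A B) :
  EFun_comp H (EFun_comp G F) = EFun_comp (EFun_comp H G) F.
Proof. by apply: EFun_ext => *; rewrite /ecell_sig /= comp_assoc. Qed.

Lemma ecell_actl (W V : Bicat) (A B : TwoSided W V) (F : EFun A B)
    w v w' v' (a : tob A w v) (b b' : tob A w' v') (x : bhom w w') (s : bhom v v')
    (p : id1 v' ~> tfun A b b' (id1 w')) (f : s ~> tfun A a b x) :
  ecell F a b' x ∘ actl p f = actl (ecell F b b' _ ∘ p) (ecell F a b x ∘ f).
Proof.
by rewrite /actl htens_comp -!comp_assoc (pre (ecell_nat _ _ _ _)) (pre (ecell_mu _ _ _ _ _ _)).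
Qed.

Lemma ecell_actr (W V : Bicat) (A B : TwoSided W V) (F : EFun A B)
    w v w' v' (a a' : tob A w v) (b : tob A w' v') (x : bhom w w') (s : bhom v v')
    (f : s ~> tfun A a' b x) (p : id1 v ~> tfun A a a' (id1 w)) :
  ecell F a b x ∘ actr f p = actr (ecell F a' b x ∘ f) (ecell F a a' _ ∘ p).
Proof.
by rewrite /actr htens_comp -!comp_assoc (pre (ecell_nat _ _ _ _)) (pre (ecell_mu _ _ _ _ _ _)).
Qed.

Lemma Tricell_eq (W V : Bicat) (A B : TwoSided W V) (F E : EFun A B)
    (p q : Tricell F E) : (forall w v (a : tob A w v), p w v a = q w v a) -> p = q.
Proof.
case: p q => p e [q e'] /= h.
have ? : p = q by do 3 apply: functional_extensionality_dep => ?; apply: h.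
subst q; by rewrite (proof_irrelevance _ e e').
Qed.

(** The identity of [F] is [eta]; the composite of [q] and [p] is
    [mu ∘ (q ⊗ p)]. *)
Program Definition Caten_hom (W V : Bicat) (A B : TwoSided W V) : Category :=
  {| obj := EFun A B;
     mor := fun F E => Tricell F E;
     idm := fun F => {| tcell := fun _ _ a => teta B (eob F a) |};
     comp := fun F E D q p => {| tcell := fun _ _ a => actl (q _ _ a) (p _ _ a) |} |}.
Next Obligation. by rewrite actl_eta actr_eta. Qed.
Next Obligation.
by rewrite -actl_actl tcell_nat actl_actr tcell_nat -actr_actr actlr.
Qed.
Next Obligation. by apply: Tricell_eq => * /=; apply: actl_eta. Qed.
Next Obligation. by apply: Tricell_eq => * /=; rewrite actlr actr_eta. Qed.
Next Obligation. by apply: Tricell_eq => * /=; apply: actl_actl. Qed.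

Lemma Tricell_swap (W V : Bicat) (A B : TwoSided W V) (F E : EFun A B)
    (p : Tricell F E) w v (a a' : tob A w v) (f : id1 v ~> tfun A a a' (id1 w)) :
  actl (p _ _ a') (ecell F a a' _ ∘ f) = actl (ecell E a a' _ ∘ f) (p _ _ a).
Proof. by rewrite actl_pre tcell_nat -actr_pre actlr. Qed.

Program Definition Caten_hcomp (W V : Bicat) (A B C : TwoSided W V)
    (G G' : EFun B C) (F F' : EFun A B) (q : Tricell G G') (p : Tricell F F') :
    Tricell (EFun_comp G F) (EFun_comp G' F') :=
  {| tcell := fun _ _ a =>
       actl (q _ _ (eob F' a)) (ecell G (eob F a) (eob F' a) _ ∘ p _ _ a) |}.
Next Obligation.
by rewrite -actl_actl -ecell_actl tcell_nat ecell_actr actl_actr actl_pre tcell_nat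
  -actr_pre -actr_actr actlr.
Qed.

Lemma arr_Tricell (W V : Bicat) (A B : TwoSided W V) (F E F' E' : Caten_hom A B)
    (p : F ~> E) (p' : F' ~> E') :
  F = F' -> E = E' ->
  (forall w v (a : tob A w v),
    existT (fun b : tob B w v * tob B w v =>
              id1 v ~> tfun B (fst b) (snd b) (id1 w)) (eob F a, eob E a) (tcell p a) =
    existT (fun b : tob B w v * tob B w v =>
              id1 v ~> tfun B (fst b) (snd b) (id1 w)) (eob F' a, eob E' a) (tcell p' a)) ->
  arr p = arr p'.
Proof.
move=> e1 e2 h; subst F' E'; congr arr; apply: Tricell_eq => w v a.
by have := inj_pair2 _ _ _ _ _ (h _ _ a).
Qed.

Program Definition Caten (W V : Bicat) : TwoCat :=
  {| c0 := TwoSided W V;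
     c1 := fun A B => Caten_hom A B;
     cid := fun A => EFun_id A;
     ccomp := fun A B C G F => EFun_comp G F;
     hcomp := fun A B C G G' F F' q p => Caten_hcomp q p |}.
Next Obligation.
by apply: Tricell_eq => * /=; rewrite actl_eta ecell_eta.
Qed.
Next Obligation.
apply: Tricell_eq => * /=; rewrite ecell_actl -!actl_actl; congr actl.
by rewrite !actl_actl -Tricell_swap.
Qed.
Next Obligation. exact: EFun_comp_idl. Qed.
Next Obligation. exact: EFun_comp_idr. Qed.
Next Obligation. exact: EFun_comp_assoc. Qed.
Next Obligation.
apply: arr_Tricell; [exact: EFun_comp_idl|exact: EFun_comp_idl|move=> * /=].
by rewrite actl_eta comp_idl.
Qed.
Next Obligation.
apply: arr_Tricell; [exact: EFun_comp_idr|exact: EFun_comp_idr|move=> * /=].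
by rewrite ecell_eta actlr actr_eta.
Qed.
Next Obligation.
apply: arr_Tricell; [exact: EFun_comp_assoc|exact: EFun_comp_assoc|move=> * /=].
by rewrite ecell_actl -!actl_actl -!comp_assoc.
Qed.

Lemma Caten_hcomp_idr (W V : Bicat) (A B C : TwoSided W V) (G G' : EFun B C)
    (F : Caten_hom A B) (q : Tricell G G') w v (a : tob A w v) :
  tcell (Caten_hcomp q (idm F)) a = q _ _ (eob F a).
Proof. by rewrite /= ecell_eta actlr actr_eta. Qed.

Lemma Caten_hcomp_idl (W V : Bicat) (A B C : TwoSided W V) (G : Caten_hom B C)
    (F F' : EFun A B) (p : Tricell F F') w v (a : tob A w v) :
  tcell (Caten_hcomp (idm G) p) a = ecell G (eob F a) (eob F' a) _ ∘ p _ _ a.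
Proof. by rewrite /= actl_eta. Qed.

Lemma arr_Caten_nat (W V : Bicat) (A B C D : TwoSided W V) (G G' : EFun B C)
    (N : Caten_hom A B) (M : Caten_hom D C) (H H' : EFun A D)
    (q : Tricell G G') (p : Tricell H H') :
  EFun_comp G N = EFun_comp M H -> EFun_comp G' N = EFun_comp M H' ->
  (forall w v (a : tob A w v),
    existT (fun b : tob C w v * tob C w v =>
              id1 v ~> tfun C (fst b) (snd b) (id1 w))
      (eob G (eob N a), eob G' (eob N a)) (tcell q (eob N a)) =
    existT (fun b : tob C w v * tob C w v =>
              id1 v ~> tfun C (fst b) (snd b) (id1 w))
      (eob M (eob H a), eob M (eob H' a))
      (ecell M (eob H a) (eob H' a) (id1 w) ∘ tcell p a)) ->
  arr (hcomp (t := Caten W V) q (idm N)) = arr (hcomp (t := Caten W V) (idm M) p).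
Proof.
move=> e e' h; apply: arr_Tricell => // w v a.
by rewrite Caten_hcomp_idr Caten_hcomp_idl; apply: h.
Qed.

Inductive id_ob (V : Type) : V -> V -> Type := id_obI v : id_ob v v.
Arguments id_obI {_} _.

Definition id_fun (V : Bicat) (w v w' v' : V) (a : id_ob w v) (a' : id_ob w' v') :
    Functor (bhom w w') (bhom v v') :=
  match a in id_ob w v, a' in id_ob w' v' return Functor (bhom w w') (bhom v v') with
  | id_obI v, id_obI v' => Functor_id (bhom v v')
  end.

Definition id_eta (V : Bicat) (w v : V) (a : id_ob w v) :
    id1 v ~> id_fun a a (id1 w) :=
  match a in id_ob w v return id1 v ~> id_fun a a (id1 w) with
  | id_obI v => idm (id1 v)
  end.

Definition id_mu (V : Bicat) (w v w' v' w'' v'' : V)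
    (a : id_ob w v) (a' : id_ob w' v') (a'' : id_ob w'' v'') :
    forall (x' : bhom w' w'') (x : bhom w w'),
    id_fun a' a'' x' # id_fun a a' x ~> id_fun a a'' (x' # x) :=
  match a in id_ob w v, a' in id_ob w' v', a'' in id_ob w'' v''
    return forall (x' : bhom w' w'') (x : bhom w w'),
      id_fun a' a'' x' # id_fun a a' x ~> id_fun a a'' (x' # x) with
  | id_obI v, id_obI v', id_obI v'' => fun x' x => idm (x' # x)
  end.

Program Definition Caten_id (V : Bicat) : TwoSided V V :=
  {| tob := @id_ob V; tfun := @id_fun V; teta := @id_eta V; tmu := @id_mu V |}.
Next Obligation. by case: a a' a'' x' y' x y q p => ? [?] [?] * /=; rewrite comp_idl comp_idr. Qed.
Next Obligation.
by case: a a' a'' a''' x'' x' x => ? [?] [?] [?] * /=; rewrite !htens_id !comp_idl !comp_idr.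
Qed.
Next Obligation. by case: a a' x => ? [?] * /=; rewrite !htens_id !comp_idr. Qed.
Next Obligation. by case: a a' x => ? [?] * /=; rewrite !htens_id !comp_idr. Qed.

Lemma tmu_natl (W V : Bicat) (A : TwoSided W V) w v w' v' w'' v''
    (a : tob A w v) (a' : tob A w' v') (a'' : tob A w'' v'')
    (x' y' : bhom w' w'') (x : bhom w w') (q : x' ~> y') :
  tmu A a a' a'' y' x ∘ (fmap (tfun A a' a'') q ## idm (tfun A a a' x)) =
  fmap (tfun A a a'') (q ## idm x) ∘ tmu A a a' a'' x' x.
Proof. by rewrite -fmap_id tmu_nat. Qed.

Lemma tmu_natr (W V : Bicat) (A : TwoSided W V) w v w' v' w'' v''
    (a : tob A w v) (a' : tob A w' v') (a'' : tob A w'' v'')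
    (x' : bhom w' w'') (x y : bhom w w') (p : x ~> y) :
  tmu A a a' a'' x' y ∘ (idm (tfun A a' a'' x') ## fmap (tfun A a a') p) =
  fmap (tfun A a a'') (idm x' ## p) ∘ tmu A a a' a'' x' x.
Proof. by rewrite -fmap_id tmu_nat. Qed.

(** The objects of [B ∘ A] over [x] and [v]: pairs [(lft, rgt)] with
    [lft_+ = mid = rgt_-]. Primitive projections give definitional eta. *)
#[projections(primitive)]
Record comp_ob (V : Type) (P Q : V -> Type) := Cob { mid : V; lft : P mid; rgt : Q mid }.
Arguments Cob {_ _ _} _ _ _.
Arguments mid {_ _ _} _.
Arguments lft {_ _ _} _.
Arguments rgt {_ _ _} _.

Program Definition Caten_comp (X W V : Bicat) (B : TwoSided W V) (A : TwoSided X W) :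
    TwoSided X V :=
  {| tob := fun x v => comp_ob (tob A x) (fun w => tob B w v);
     tfun := fun _ _ _ _ c c' =>
       Functor_comp (tfun B (rgt c) (rgt c')) (tfun A (lft c) (lft c'));
     teta := fun _ _ c =>
       fmap (tfun B (rgt c) (rgt c)) (teta A (lft c)) ∘ teta B (rgt c);
     tmu := fun _ _ _ _ _ _ c c' c'' x' x =>
       fmap (tfun B (rgt c) (rgt c'')) (tmu A (lft c) (lft c') (lft c'') x' x) ∘
         tmu B (rgt c) (rgt c') (rgt c'') _ _ |}.
Next Obligation.
by rewrite -comp_assoc tmu_nat !comp_assoc -!fmap_comp tmu_nat.
Qed.
Next Obligation.
rewrite hsplitl hsplitr -!comp_assoc.
rewrite (pre (tmu_natl _ _ _ _ _)) (pre (tmu_natr _ _ _ _ _)).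
by rewrite -tmu_ass !comp_assoc -!fmap_comp -!comp_assoc tmu_ass.
Qed.
Next Obligation.
rewrite hsplitl -!comp_assoc (pre (tmu_natl _ _ _ _ _)).
rewrite -(tmu_lun (rgt a) (rgt a')) -(tmu_lun (lft a) (lft a')).
by rewrite !fmap_comp -!comp_assoc.
Qed.
Next Obligation.
rewrite hsplitr -!comp_assoc (pre (tmu_natr _ _ _ _ _)).
rewrite -(tmu_run (rgt a) (rgt a')) -(tmu_run (lft a) (lft a')).
by rewrite !fmap_comp -!comp_assoc.
Qed.

Program Definition whisk_l (X W V : Bicat) (B : TwoSided W V) (A A' : TwoSided X W)
    (F : EFun A A') : EFun (Caten_comp B A) (Caten_comp B A') :=
  {| eob := fun x v (c : tob (Caten_comp B A) x v) =>
       Cob (mid c) (eob F (lft c)) (rgt c) : tob (Caten_comp B A') x v;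
     ecell := fun _ _ _ _ c c' x =>
       fmap (tfun B (rgt c) (rgt c')) (ecell F (lft c) (lft c') x) |}.
Next Obligation. by rewrite -!fmap_comp ecell_nat. Qed.
Next Obligation.
by rewrite comp_assoc -fmap_comp ecell_mu fmap_comp -!comp_assoc tmu_nat.
Qed.
Next Obligation. by rewrite comp_assoc -fmap_comp ecell_eta. Qed.

Program Definition whisk_r (X W V : Bicat) (B B' : TwoSided W V) (H : EFun B B')
    (A : TwoSided X W) : EFun (Caten_comp B A) (Caten_comp B' A) :=
  {| eob := fun x v (c : tob (Caten_comp B A) x v) =>
       Cob (mid c) (lft c) (eob H (rgt c)) : tob (Caten_comp B' A) x v;
     ecell := fun _ _ _ _ c c' x =>
       ecell H (rgt c) (rgt c') (tfun A (lft c) (lft c') x) |}.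
Next Obligation. exact: ecell_nat. Qed.
Next Obligation. by rewrite comp_assoc ecell_nat -comp_assoc ecell_mu comp_assoc. Qed.
Next Obligation. by rewrite comp_assoc ecell_nat -comp_assoc ecell_eta. Qed.

Ltac split_r c := let r := fresh in destruct c as [? ? r]; destruct r.
Ltac split_l c := let r := fresh in destruct c as [? r ?]; destruct r.

Definition lunit_ob (X V : Bicat) (A : TwoSided X V) x v
    (c : comp_ob (tob A x) (fun w => id_ob w v)) : tob A x v :=
  match rgt c in id_ob w v return tob A x w -> tob A x v with
  | id_obI _ => fun a => a
  end (lft c).

Definition lunit_cell (X V : Bicat) (A : TwoSided X V) x v x' v'
    (c : tob (Caten_comp (Caten_id V) A) x v)
    (c' : tob (Caten_comp (Caten_id V) A) x' v') (f : bhom x x') :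
    tfun (Caten_comp (Caten_id V) A) c c' f ~> tfun A (lunit_ob c) (lunit_ob c') f :=
  match rgt c as r in id_ob w v, rgt c' as r' in id_ob w' v'
    return forall (a : tob A x w) (a' : tob A x' w'),
      tfun (Caten_comp (Caten_id V) A) (Cob w a r) (Cob w' a' r') f ~>
      tfun A (lunit_ob (Cob w a r)) (lunit_ob (Cob w' a' r')) f with
  | id_obI _, id_obI _ => fun a a' => idm (tfun A a a' f)
  end (lft c) (lft c').

Program Definition lunit (X V : Bicat) (A : TwoSided X V) :
    EFun (Caten_comp (Caten_id V) A) A :=
  {| eob := @lunit_ob X V A; ecell := @lunit_cell X V A |}.
Next Obligation.
by split_r a; split_r a'; rewrite /= comp_idl comp_idr.
Qed.
Next Obligation.
split_r a; split_r a'; split_r a''.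
by rewrite /= htens_id !comp_idl !comp_idr.
Qed.
Next Obligation. by split_r a; rewrite /= comp_idl comp_idr. Qed.

Definition runit_ob (X V : Bicat) (A : TwoSided X V) x v
    (c : comp_ob (id_ob x) (fun w => tob A w v)) : tob A x v :=
  match lft c in id_ob x w return tob A w v -> tob A x v with
  | id_obI _ => fun a => a
  end (rgt c).

Definition runit_cell (X V : Bicat) (A : TwoSided X V) x v x' v'
    (c : tob (Caten_comp A (Caten_id X)) x v)
    (c' : tob (Caten_comp A (Caten_id X)) x' v') :
    forall (f : bhom x x'),
    tfun (Caten_comp A (Caten_id X)) c c' f ~> tfun A (runit_ob c) (runit_ob c') f :=
  match lft c as r in id_ob x w, lft c' as r' in id_ob x' w'
    return forall (a : tob A w v) (a' : tob A w' v') (f : bhom x x'),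
      tfun (Caten_comp A (Caten_id X)) (Cob w r a) (Cob w' r' a') f ~>
      tfun A (runit_ob (Cob w r a)) (runit_ob (Cob w' r' a')) f with
  | id_obI _, id_obI _ => fun a a' f => idm (tfun A a a' f)
  end (rgt c) (rgt c').

Program Definition runit (X V : Bicat) (A : TwoSided X V) :
    EFun (Caten_comp A (Caten_id X)) A :=
  {| eob := @runit_ob X V A; ecell := @runit_cell X V A |}.
Next Obligation.
split_l a; split_l a'.
by rewrite /= comp_idl comp_idr.
Qed.
Next Obligation.
split_l a; split_l a'; split_l a''.
by rewrite /= htens_id fmap_id !comp_idl !comp_idr.
Qed.
Next Obligation. by split_l a; rewrite /= fmap_id comp_idl comp_idl. Qed.

Program Definition runitV (X V : Bicat) (A : TwoSided X V) :
    EFun A (Caten_comp A (Caten_id X)) :=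
  {| eob := fun x v (a : tob A x v) =>
       Cob x (id_obI x) a : tob (Caten_comp A (Caten_id X)) x v;
     ecell := fun _ _ _ _ a a' f => idm (tfun A a a' f) |}.
Next Obligation. by rewrite comp_idl comp_idr. Qed.
Next Obligation. by rewrite htens_id fmap_id comp_idr. Qed.
Next Obligation. by rewrite fmap_id comp_idl. Qed.

Program Definition assoc (X W V U : Bicat) (C : TwoSided V U) (B : TwoSided W V)
    (A : TwoSided X W) :
    EFun (Caten_comp (Caten_comp C B) A) (Caten_comp C (Caten_comp B A)) :=
  {| eob := fun x u (c : tob (Caten_comp (Caten_comp C B) A) x u) =>
       Cob (mid (rgt c)) (Cob (mid c) (lft c) (lft (rgt c))) (rgt (rgt c))
         : tob (Caten_comp C (Caten_comp B A)) x u;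
     ecell := fun _ _ _ _ c c' f =>
       idm (tfun (Caten_comp (Caten_comp C B) A) c c' f) |}.
Next Obligation. by rewrite comp_idl comp_idr. Qed.
Next Obligation. by rewrite htens_id fmap_comp comp_idl comp_idr comp_assoc. Qed.
Next Obligation. by rewrite fmap_comp comp_idl comp_assoc. Qed.

Program Definition assocV (X W V U : Bicat) (C : TwoSided V U) (B : TwoSided W V)
    (A : TwoSided X W) :
    EFun (Caten_comp C (Caten_comp B A)) (Caten_comp (Caten_comp C B) A) :=
  {| eob := fun x u (c : tob (Caten_comp C (Caten_comp B A)) x u) =>
       Cob (mid (lft c)) (lft (lft c)) (Cob (mid c) (rgt (lft c)) (rgt c))
         : tob (Caten_comp (Caten_comp C B) A) x u;
     ecell := fun _ _ _ _ c c' f =>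
       idm (tfun (Caten_comp C (Caten_comp B A)) c c' f) |}.
Next Obligation. by rewrite comp_idl comp_idr. Qed.
Next Obligation. by rewrite htens_id fmap_comp comp_idl comp_idr comp_assoc. Qed.
Next Obligation. by rewrite fmap_comp comp_idl comp_assoc. Qed.

Notation "G ⊙ F" := (EFun_comp G F) (at level 48, right associativity).

Lemma whisk_l_id (X W V : Bicat) (B : TwoSided W V) (A : TwoSided X W) :
  whisk_l B (EFun_id A) = EFun_id (Caten_comp B A).
Proof. by apply: EFun_ext => *; rewrite /ecell_sig /= fmap_id. Qed.

Lemma whisk_l_comp (X W V : Bicat) (B : TwoSided W V) (A A' A'' : TwoSided X W)
    (E : EFun A' A'') (F : EFun A A') :
  whisk_l B (E ⊙ F) = whisk_l B E ⊙ whisk_l B F.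
Proof. by apply: EFun_ext => *; rewrite /ecell_sig /= fmap_comp. Qed.

Lemma whisk_r_id (X W V : Bicat) (B : TwoSided W V) (A : TwoSided X W) :
  whisk_r (EFun_id B) A = EFun_id (Caten_comp B A).
Proof. by apply: EFun_ext. Qed.

Lemma whisk_r_comp (X W V : Bicat) (B B' B'' : TwoSided W V) (H : EFun B' B'')
    (K : EFun B B') (A : TwoSided X W) :
  whisk_r (H ⊙ K) A = whisk_r H A ⊙ whisk_r K A.
Proof. by apply: EFun_ext. Qed.

Lemma whisk_swap (X W V : Bicat) (B B' : TwoSided W V) (H : EFun B B')
    (A A' : TwoSided X W) (F : EFun A A') :
  whisk_l B' F ⊙ whisk_r H A = whisk_r H A' ⊙ whisk_l B F.
Proof. by apply: EFun_ext => *; rewrite /ecell_sig /= ecell_nat. Qed.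

Lemma lunit_nat (X V : Bicat) (A A' : TwoSided X V) (F : EFun A A') :
  F ⊙ lunit A = lunit A' ⊙ whisk_l (Caten_id V) F.
Proof.
apply: EFun_ext => x v x' v' a a' f; split_r a; split_r a'.
by rewrite /ecell_sig /= comp_idl comp_idr.
Qed.

Lemma assoc_nat_l (X W V U : Bicat) (C : TwoSided V U) (B : TwoSided W V)
    (A A' : TwoSided X W) (F : EFun A A') :
  whisk_l C (whisk_l B F) ⊙ assoc C B A = assoc C B A' ⊙ whisk_l (Caten_comp C B) F.
Proof. by apply: EFun_ext => *; rewrite /ecell_sig /= comp_idl comp_idr. Qed.

Lemma assoc_nat_m (X W V U : Bicat) (C : TwoSided V U) (B B' : TwoSided W V)
    (H : EFun B B') (A : TwoSided X W) :
  whisk_l C (whisk_r H A) ⊙ assoc C B A = assoc C B' A ⊙ whisk_r (whisk_l C H) A.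
Proof. by apply: EFun_ext => *; rewrite /ecell_sig /= comp_idl comp_idr. Qed.

Lemma assoc_nat_r (X W V U : Bicat) (C C' : TwoSided V U) (H : EFun C C')
    (B : TwoSided W V) (A : TwoSided X W) :
  whisk_r H (Caten_comp B A) ⊙ assoc C B A = assoc C' B A ⊙ whisk_r (whisk_r H B) A.
Proof. by apply: EFun_ext => *; rewrite /ecell_sig /= comp_idl comp_idr. Qed.

Lemma assoc_pentagon (X W V U T : Bicat) (D : TwoSided U T) (C : TwoSided V U)
    (B : TwoSided W V) (A : TwoSided X W) :
  assoc D C (Caten_comp B A) ⊙ assoc (Caten_comp D C) B A =
  whisk_l D (assoc C B A) ⊙ assoc D (Caten_comp C B) A ⊙ whisk_r (assoc D C B) A.
Proof. by apply: EFun_ext => *; rewrite /ecell_sig /= fmap_id !comp_idl. Qed.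

Lemma lunit_assoc (X W V : Bicat) (B : TwoSided W V) (A : TwoSided X W) :
  lunit (Caten_comp B A) ⊙ assoc (Caten_id V) B A = whisk_r (lunit B) A.
Proof.
apply: EFun_ext => x v x' v' [w a b] [w' a' b'] f; split_r b; split_r b'.
by rewrite /ecell_sig /= comp_idl.
Qed.

Lemma lunit_runit_assoc (X W V : Bicat) (B : TwoSided W V) (A : TwoSided X W) :
  whisk_l B (lunit A) ⊙ assoc B (Caten_id W) A = whisk_r (runit B) A.
Proof.
apply: EFun_ext => x v x' v' [w a b] [w' a' b'] f; split_l b; split_l b'.
by rewrite /ecell_sig /= fmap_id comp_idl.
Qed.

Program Definition TwoNat_comp (K L : TwoCat) (S T U : TwoFunctor K L)
    (t : TwoNat T U) (s : TwoNat S T) : TwoNat S U :=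
  {| n0 := fun a => t a • s a |}.
Next Obligation. by rewrite ccomp_assoc n1 -ccomp_assoc n1 ccomp_assoc. Qed.
Next Obligation.
rewrite -!hcomp_id hcomp_assoc.
transitivity (arr ((idm (t b) ★ F2 T p) ★ idm (s a))).
  by apply: arr_hcomp => //; apply: n2.
rewrite -!hcomp_assoc.
by apply: arr_hcomp => //; apply: n2.
Qed.

Lemma comp_actl (X W V : Bicat) (B : TwoSided W V) (A : TwoSided X W)
    x v w x' v' w' (a : tob A x w) (b : tob B w v) (a' a'' : tob A x' w')
    (b' : tob B w' v') (f : bhom x x') (s : bhom w w')
    (p : id1 w' ~> tfun A a' a'' (id1 x')) (g : s ~> tfun A a a' f) :
  @actl X V (Caten_comp B A) x v x' v' (Cob w a b) (Cob w' a' b') (Cob w' a'' b') f _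
    (fmap (tfun B b' b') p ∘ teta B b') (fmap (tfun B b b') g) =
  fmap (tfun B b b') (actl p g).
Proof.
rewrite /actl /= !fmap_comp -!comp_assoc; congr (_ ∘ _); congr (_ ∘ _).
have -> : (fmap (tfun B b' b') p ∘ teta B b') ## fmap (tfun B b b') g =
   (fmap (tfun B b' b') p ## fmap (tfun B b b') g) ∘ (teta B b' ## idm _).
  by rewrite -htens_comp comp_idr.
rewrite -!comp_assoc (pre (tmu_nat _ _ _ _ _)); congr (_ ∘ _).
apply: (cancel_post (i := fmap (tfun B b b') (lun s)) (j := fmap (tfun B b b') (lunV s))).
  by rewrite -fmap_comp lunK fmap_id.
rewrite -fmap_comp lunVK fmap_id.
by apply: eq_trans (lunVK (tfun B b b' s)); rewrite -tmu_lun -!comp_assoc.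
Qed.

Lemma comp_actr (X W V : Bicat) (B : TwoSided W V) (A : TwoSided X W)
    x v w x' v' w' (a a' : tob A x w) (b : tob B w v) (a'' : tob A x' w')
    (b' : tob B w' v') (f : bhom x x') (s : bhom w w')
    (g : s ~> tfun A a' a'' f) (p : id1 w ~> tfun A a a' (id1 x)) :
  @actr X V (Caten_comp B A) x v x' v' (Cob w a b) (Cob w a' b) (Cob w' a'' b') f _
    (fmap (tfun B b b') g) (fmap (tfun B b b) p ∘ teta B b) =
  fmap (tfun B b b') (actr g p).
Proof.
rewrite /actr /= !fmap_comp -!comp_assoc; congr (_ ∘ _); congr (_ ∘ _).
have -> : fmap (tfun B b b') g ## (fmap (tfun B b b) p ∘ teta B b) =
   (fmap (tfun B b b') g ## fmap (tfun B b b) p) ∘ (idm _ ## teta B b).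
  by rewrite -htens_comp comp_idr.
rewrite -!comp_assoc (pre (tmu_nat _ _ _ _ _)); congr (_ ∘ _).
apply: (cancel_post (i := fmap (tfun B b b') (run s)) (j := fmap (tfun B b b') (runV s))).
  by rewrite -fmap_comp runK fmap_id.
rewrite -fmap_comp runVK fmap_id.
by apply: eq_trans (runVK (tfun B b b' s)); rewrite -tmu_run -!comp_assoc.
Qed.

Program Definition whisk_cell (X W V : Bicat) (B : TwoSided W V) (A A' : TwoSided X W)
    (F E : EFun A A') (p : Tricell F E) : Tricell (whisk_l B F) (whisk_l B E) :=
  {| tcell := fun x v (c : tob (Caten_comp B A) x v) =>
       fmap (tfun B (rgt c) (rgt c)) (tcell p (lft c)) ∘ teta B (rgt c) |}.
Next Obligation. by rewrite comp_actl comp_actr tcell_nat. Qed.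

Program Definition postcomp (X W V : Bicat) (B : TwoSided W V) :
    TwoFunctor (Caten X W) (Caten X V) :=
  {| F0 := (fun A => Caten_comp B A) : Caten X W -> Caten X V;
     F1 := fun A A' =>
       {| fobj := (fun F => whisk_l B F) : Caten_hom A A' -> Caten_hom _ _;
          fmap := fun F E p => whisk_cell B p |} |}.
Next Obligation. by apply: Tricell_eq. Qed.
Next Obligation.
by apply: Tricell_eq => * /=; rewrite actl_pre comp_actl.
Qed.
Next Obligation. exact: whisk_l_id. Qed.
Next Obligation. exact: whisk_l_comp. Qed.
Next Obligation.
apply: arr_Tricell; [exact: whisk_l_comp|exact: whisk_l_comp|move=> * /=].
by rewrite comp_assoc -fmap_comp [in RHS]actl_pre comp_actl.
Qed.

Program Definition postcomp_nat (X W V : Bicat) (B B' : TwoSided W V) (H : EFun B B') :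
    TwoNat (postcomp X B) (postcomp X B') :=
  {| n0 := (fun A => whisk_r H A) : forall A : Caten X W, c1 (postcomp X B A) _ |}.
Next Obligation. exact: whisk_swap. Qed.
Next Obligation.
apply: arr_Caten_nat; [exact: whisk_swap|exact: whisk_swap|move=> * /=].
by rewrite comp_assoc ecell_nat -comp_assoc ecell_eta.
Qed.

Program Definition lunit_Nat (X V : Bicat) :
    TwoNat (postcomp X (Caten_id V)) (TwoFunctor_id (Caten X V)) :=
  {| n0 := (fun A => lunit A) : forall A : Caten X V, c1 (postcomp X (Caten_id V) A) A |}.
Next Obligation. exact: lunit_nat. Qed.
Next Obligation.
apply: arr_Caten_nat; [exact: lunit_nat|exact: lunit_nat|].
by move=> w v c; split_r c; rewrite /= comp_idl comp_idr.
Qed.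

Program Definition assoc_Nat (X W V U : Bicat) (C : TwoSided V U) (B : TwoSided W V) :
    TwoNat (postcomp X (Caten_comp C B))
      (TwoFunctor_comp (postcomp X C) (postcomp X B)) :=
  {| n0 := (fun A => assoc C B A) :
       forall A : Caten X W, c1 (postcomp X (Caten_comp C B) A) _ |}.
Next Obligation. exact: assoc_nat_l. Qed.
Next Obligation.
apply: arr_Caten_nat; [exact: assoc_nat_l|exact: assoc_nat_l|move=> * /=].
by rewrite comp_idl fmap_comp comp_assoc.
Qed.

Record Caten_comonad (V : Bicat) := {
  cc_G :> TwoSided V V;
  cc_e : EFun cc_G (Caten_id V);
  cc_d : EFun cc_G (Caten_comp cc_G cc_G);
  cc_counit_l : lunit cc_G ⊙ whisk_r cc_e cc_G ⊙ cc_d = EFun_id cc_G;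
  cc_counit_r : runit cc_G ⊙ whisk_l cc_G cc_e ⊙ cc_d = EFun_id cc_G;
  cc_coassoc : assoc cc_G cc_G cc_G ⊙ whisk_r cc_d cc_G ⊙ cc_d =
    whisk_l cc_G cc_d ⊙ cc_d
}.
Arguments cc_e {_} _.
Arguments cc_d {_} _.

(** The 2-comonad [Caten(X, G) = G ∘ -] on [Caten(X, V)]. *)
Program Definition induced (X V : Bicat) (G : Caten_comonad V) :
    TwoComonad (Caten X V) :=
  {| cmT := postcomp X G;
     cme := TwoNat_comp (lunit_Nat X V) (postcomp_nat X (cc_e G));
     cmd := TwoNat_comp (assoc_Nat X G G) (postcomp_nat X (cc_d G)) |}.
Next Obligation.
rewrite (EFun_comp_assoc (lunit _ ⊙ _)) -(EFun_comp_assoc (lunit _)) assoc_nat_r.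
rewrite (EFun_comp_assoc (lunit _)) lunit_assoc -!whisk_r_comp.
by rewrite -EFun_comp_assoc cc_counit_l whisk_r_id.
Qed.
Next Obligation.
rewrite whisk_l_comp (EFun_comp_assoc (_ ⊙ _)) -(EFun_comp_assoc (whisk_l _ (lunit _))).
rewrite assoc_nat_m (EFun_comp_assoc (whisk_l _ (lunit _))) lunit_runit_assoc.
by rewrite -!whisk_r_comp -EFun_comp_assoc cc_counit_r whisk_r_id.
Qed.
Next Obligation.
rewrite whisk_l_comp (EFun_comp_assoc (assoc _ _ _ ⊙ _)) -(EFun_comp_assoc (assoc _ _ _)).
rewrite assoc_nat_r (EFun_comp_assoc (assoc _ _ _)) assoc_pentagon.
rewrite -!EFun_comp_assoc -!whisk_r_comp cc_coassoc.
rewrite (EFun_comp_assoc (whisk_l _ (whisk_r _ _))) assoc_nat_m.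
by rewrite -!EFun_comp_assoc -whisk_r_comp.
Qed.

Record Caten_coaction (V : Bicat) (G : Caten_comonad V) (E : Bicat)
    (S : TwoSided E V) := {
  ck_act :> EFun S (Caten_comp G S);
  ck_counit : lunit S ⊙ whisk_r (cc_e G) S ⊙ ck_act = EFun_id S;
  ck_coassoc : assoc G G S ⊙ whisk_r (cc_d G) S ⊙ ck_act =
    whisk_l G ck_act ⊙ ck_act
}.

Program Definition postcomp_coaction (X V : Bicat) (G : Caten_comonad V)
    (E : Bicat) (S : TwoSided E V) (k : Caten_coaction G S) :
    Coaction (induced X G) (postcomp X S) :=
  {| ca_nat := TwoNat_comp (assoc_Nat X G S) (postcomp_nat X k) |}.
Next Obligation.
rewrite (EFun_comp_assoc (lunit _ ⊙ _)) -(EFun_comp_assoc (lunit _)) assoc_nat_r.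
rewrite (EFun_comp_assoc (lunit _)) lunit_assoc -!whisk_r_comp.
by rewrite -EFun_comp_assoc ck_counit whisk_r_id.
Qed.
Next Obligation.
rewrite whisk_l_comp (EFun_comp_assoc (assoc _ _ _ ⊙ _)) -(EFun_comp_assoc (assoc _ _ _)).
rewrite assoc_nat_r (EFun_comp_assoc (assoc _ _ _)) assoc_pentagon.
rewrite -!EFun_comp_assoc -!whisk_r_comp ck_coassoc.
rewrite (EFun_comp_assoc (whisk_l _ (whisk_r _ _))) assoc_nat_m.
by rewrite -!EFun_comp_assoc -whisk_r_comp.
Qed.

(** The comparison sends [A : X -> E] to [S ∘ A] with the coaction
    [S ∘ A -> (G ∘ S) ∘ A = G ∘ (S ∘ A)]. *)
Definition is_EM_object (V : Bicat) (G : Caten_comonad V) (E : Bicat)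
    (S : TwoSided E V) (k : Caten_coaction G S) : Prop :=
  forall X : Bicat, is_2equivalence (comparison (postcomp_coaction X k)).

(** The data of a comonad on [V] in Caten spelled out, once [G_- = G_+ = G_0]
    for each of its objects [G]; see [explicit] below. *)
Record Comonad (V : Bicat) := {
  g_ob : Type;
  g_0 : g_ob -> V;
  g_fun : forall o o', Functor (bhom (g_0 o) (g_0 o')) (bhom (g_0 o) (g_0 o'));
  g_eta : forall o, id1 (g_0 o) ~> g_fun o o (id1 (g_0 o));
  g_mu : forall o o' o'' (x' : bhom (g_0 o') (g_0 o'')) (x : bhom (g_0 o) (g_0 o')),
    g_fun o' o'' x' # g_fun o o' x ~> g_fun o o'' (x' # x);
  g_d : forall o o' (x : bhom (g_0 o) (g_0 o')), g_fun o o' x ~> g_fun o o' (g_fun o o' x);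
  g_e : forall o o' (x : bhom (g_0 o) (g_0 o')), g_fun o o' x ~> x;
  g_mu_nat : forall o o' o'' (x' y' : bhom (g_0 o') (g_0 o''))
      (x y : bhom (g_0 o) (g_0 o')) (q : x' ~> y') (p : x ~> y),
    g_mu y' y ∘ (fmap (g_fun o' o'') q ## fmap (g_fun o o') p) =
    fmap (g_fun o o'') (q ## p) ∘ g_mu x' x;
  g_mu_ass : forall o o' o'' o''' (x'' : bhom (g_0 o'') (g_0 o'''))
      (x' : bhom (g_0 o') (g_0 o'')) (x : bhom (g_0 o) (g_0 o')),
    fmap (g_fun o o''') (ass x'' x' x) ∘ g_mu (x'' # x') x ∘
      (g_mu x'' x' ## idm (g_fun o o' x)) =
    g_mu x'' (x' # x) ∘
      (idm (g_fun o'' o''' x'') ## g_mu x' x) ∘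
      ass (g_fun o'' o''' x'') (g_fun o' o'' x') (g_fun o o' x);
  g_mu_lun : forall o o' (x : bhom (g_0 o) (g_0 o')),
    fmap (g_fun o o') (lun x) ∘ g_mu (id1 _) x ∘
      (g_eta o' ## idm (g_fun o o' x)) = lun (g_fun o o' x);
  g_mu_run : forall o o' (x : bhom (g_0 o) (g_0 o')),
    fmap (g_fun o o') (run x) ∘ g_mu x (id1 _) ∘
      (idm (g_fun o o' x) ## g_eta o) = run (g_fun o o' x);
  g_d_nat : forall o o' (x y : bhom (g_0 o) (g_0 o')) (p : x ~> y),
    g_d y ∘ fmap (g_fun o o') p =
    fmap (g_fun o o') (fmap (g_fun o o') p) ∘ g_d x;
  g_e_nat : forall o o' (x y : bhom (g_0 o) (g_0 o')) (p : x ~> y),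
    g_e y ∘ fmap (g_fun o o') p = p ∘ g_e x;
  g_counit_l : forall o o' (x : bhom (g_0 o) (g_0 o')),
    g_e (g_fun o o' x) ∘ g_d x = idm _;
  g_counit_r : forall o o' (x : bhom (g_0 o) (g_0 o')),
    fmap (g_fun o o') (g_e x) ∘ g_d x = idm _;
  g_coassoc : forall o o' (x : bhom (g_0 o) (g_0 o')),
    g_d (g_fun o o' x) ∘ g_d x = fmap (g_fun o o') (g_d x) ∘ g_d x;
  g_e_mu : forall o o' o'' (x' : bhom (g_0 o') (g_0 o'')) (x : bhom (g_0 o) (g_0 o')),
    g_e (x' # x) ∘ g_mu x' x = g_e x' ## g_e x;
  g_e_eta : forall o, g_e (id1 _) ∘ g_eta o = idm (id1 (g_0 o));
  g_d_mu : forall o o' o'' (x' : bhom (g_0 o') (g_0 o'')) (x : bhom (g_0 o) (g_0 o')),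
    g_d (x' # x) ∘ g_mu x' x =
    fmap (g_fun o o'') (g_mu x' x) ∘
      g_mu (g_fun o' o'' x') (g_fun o o' x) ∘ (g_d x' ## g_d x);
  g_d_eta : forall o,
    g_d (id1 _) ∘ g_eta o = fmap (g_fun o o) (g_eta o) ∘ g_eta o
}.
Arguments g_fun {_ _} _ _.
Arguments g_eta {_ _} _.
Arguments g_mu {_ _ _ _ _} _ _.
Arguments g_d {_ _ _ _} _.
Arguments g_e {_ _ _ _} _.

Section EilenbergMoore.
Context (V : Bicat) (G : Comonad V).

Record EMcoalg (o o' : g_ob G) := {
  em_ob :> bhom (g_0 o) (g_0 o');
  em_act : em_ob ~> g_fun o o' em_ob;
  em_counit : g_e em_ob ∘ em_act = idm em_ob;
  em_coassoc : g_d em_ob ∘ em_act = fmap (g_fun o o') em_act ∘ em_act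
}.
Arguments em_act {_ _} _.

Record EMmor (o o' : g_ob G) (x y : EMcoalg o o') := {
  em_mor :> em_ob x ~> em_ob y;
  em_sq : em_act y ∘ em_mor = fmap (g_fun o o') em_mor ∘ em_act x
}.

Lemma EMmor_eq o o' (x y : EMcoalg o o') (f g : EMmor x y) :
  em_mor f = em_mor g -> f = g.
Proof.
case: f g => f e [g e'] /= h; subst g.
by rewrite (proof_irrelevance _ e e').
Qed.

Program Definition EMhom (o o' : g_ob G) : Category :=
  {| obj := EMcoalg o o'; mor := @EMmor o o';
     idm := fun x => {| em_mor := idm (em_ob x) |};
     comp := fun x y z g f => {| em_mor := em_mor g ∘ em_mor f |} |}.
Next Obligation. by rewrite fmap_id comp_idl comp_idr. Qed.
Next Obligation. by rewrite fmap_comp comp_assoc em_sq -comp_assoc em_sq comp_assoc. Qed.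
Next Obligation. apply: EMmor_eq; exact: comp_idl. Qed.
Next Obligation. apply: EMmor_eq; exact: comp_idr. Qed.
Next Obligation. apply: EMmor_eq; exact: comp_assoc. Qed.

Program Definition EM_id (o : g_ob G) : EMhom o o :=
  {| em_ob := id1 (g_0 o); em_act := g_eta o |}.
Next Obligation. exact: g_e_eta. Qed.
Next Obligation. exact: g_d_eta. Qed.

Program Definition EM_tens (o o' o'' : g_ob G) (y : EMhom o' o'') (x : EMhom o o') :
    EMhom o o'' :=
  {| em_ob := em_ob y # em_ob x; em_act := g_mu y x ∘ (em_act y ## em_act x) |}.
Next Obligation. by rewrite comp_assoc g_e_mu -htens_comp !em_counit htens_id. Qed.
Next Obligation.
rewrite comp_assoc g_d_mu -!comp_assoc -htens_comp !em_coassoc htens_comp.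
by rewrite (pre (g_mu_nat _ _)) fmap_comp -!comp_assoc.
Qed.

Program Definition EM_htens (o o' o'' : g_ob G) (y y' : EMhom o' o'')
    (x x' : EMhom o o') (q : y ~> y') (p : x ~> x') : EM_tens y x ~> EM_tens y' x' :=
  {| em_mor := em_mor q ## em_mor p |}.
Next Obligation.
by rewrite -comp_assoc -htens_comp !em_sq htens_comp (pre (g_mu_nat _ _)).
Qed.

Program Definition EM_inv (o o' : g_ob G) (x y : EMhom o o') (f : x ~> y)
    (g : em_ob y ~> em_ob x) (gf : g ∘ em_mor f = idm _) (fg : em_mor f ∘ g = idm _) :
    y ~> x := {| em_mor := g |}.
Next Obligation.
rewrite -(comp_idr (em_act y)) -fg (pre (em_sq f)) comp_assoc -fmap_comp gf.
by rewrite fmap_id comp_idl.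
Qed.

Program Definition EM_lun (o o' : g_ob G) (x : EMhom o o') :
    EM_tens (EM_id o') x ~> x := {| em_mor := lun (em_ob x) |}.
Next Obligation.
by rewrite hl -lun_nat -g_mu_lun -!comp_assoc.
Qed.

Program Definition EM_run (o o' : g_ob G) (x : EMhom o o') :
    EM_tens x (EM_id o) ~> x := {| em_mor := run (em_ob x) |}.
Next Obligation.
by rewrite hr -run_nat -g_mu_run -!comp_assoc.
Qed.

Program Definition EM_ass (o o' o'' o''' : g_ob G) (z : EMhom o'' o''')
    (y : EMhom o' o'') (x : EMhom o o') :
    EM_tens (EM_tens z y) x ~> EM_tens z (EM_tens y x) :=
  {| em_mor := ass (em_ob z) (em_ob y) (em_ob x) |}.
Next Obligation.
rewrite -{1}(comp_idl (em_act z)) htens_comp -!comp_assoc -ass_nat.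
rewrite -{2}(comp_idl (em_act x)) htens_comp !comp_assoc.
by rewrite -(comp_assoc (fmap _ _)) g_mu_ass !comp_assoc.
Qed.

Program Definition EM : Bicat :=
  {| bob := g_ob G; bhom := EMhom; id1 := EM_id; tens := EM_tens; htens := EM_htens;
     lun := EM_lun; run := EM_run; ass := EM_ass;
     lunV := fun o o' x => EM_inv (f := EM_lun x) (lunK _) (lunVK _);
     runV := fun o o' x => EM_inv (f := EM_run x) (runK _) (runVK _);
     assV := fun o o' o'' o''' z y x =>
       EM_inv (f := EM_ass z y x) (assK _ _ _) (assVK _ _ _) |}.
Next Obligation. apply: EMmor_eq; exact: htens_id. Qed.
Next Obligation. apply: EMmor_eq; exact: htens_comp. Qed.
Next Obligation. apply: EMmor_eq; exact: lunK. Qed.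
Next Obligation. apply: EMmor_eq; exact: lunVK. Qed.
Next Obligation. apply: EMmor_eq; exact: lun_nat. Qed.
Next Obligation. apply: EMmor_eq; exact: runK. Qed.
Next Obligation. apply: EMmor_eq; exact: runVK. Qed.
Next Obligation. apply: EMmor_eq; exact: run_nat. Qed.
Next Obligation. apply: EMmor_eq; exact: assK. Qed.
Next Obligation. apply: EMmor_eq; exact: assVK. Qed.
Next Obligation. apply: EMmor_eq; exact: ass_nat. Qed.
Next Obligation. apply: EMmor_eq; exact: triangle. Qed.
Next Obligation. apply: EMmor_eq; exact: pentagon. Qed.
End EilenbergMoore.
Arguments em_act {_ _ _ _} _.

Section ForgetfulAndCofree.
Context (V : Bicat) (G : Comonad V).

Inductive U_ob : EM G -> V -> Type := U_obI (o : EM G) : U_ob o (g_0 o).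

Definition EM_forget (o o' : EM G) : Functor (bhom o o') (bhom (g_0 o) (g_0 o')) :=
  {| fobj := fun x : EMhom o o' => em_ob x;
     fmap := fun x y (f : EMmor x y) => em_mor f;
     fmap_id := fun _ => eq_refl; fmap_comp := fun _ _ _ _ _ => eq_refl |}.

Definition U_fun (o : EM G) (v : V) (o' : EM G) (v' : V) (a : U_ob o v)
    (a' : U_ob o' v') : Functor (bhom o o') (bhom v v') :=
  match a in U_ob o v, a' in U_ob o' v' return Functor (bhom o o') (bhom v v') with
  | U_obI o, U_obI o' => EM_forget o o'
  end.

Definition U_eta (o : EM G) (v : V) (a : U_ob o v) : id1 v ~> U_fun a a (id1 o) :=
  match a in U_ob o v return id1 v ~> U_fun a a (id1 o) with
  | U_obI o => idm (id1 (g_0 o))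
  end.

Definition U_mu (o : EM G) (v : V) (o' : EM G) (v' : V) (o'' : EM G) (v'' : V)
    (a : U_ob o v) (a' : U_ob o' v') (a'' : U_ob o'' v'') :
    forall (x' : bhom o' o'') (x : bhom o o'),
    U_fun a' a'' x' # U_fun a a' x ~> U_fun a a'' (x' # x) :=
  match a in U_ob o v, a' in U_ob o' v', a'' in U_ob o'' v''
    return forall (x' : bhom o' o'') (x : bhom o o'),
      U_fun a' a'' x' # U_fun a a' x ~> U_fun a a'' (x' # x) with
  | U_obI o, U_obI o', U_obI o'' => fun x' x => idm (em_ob x' # em_ob x)
  end.

(** The object [o] of [V^G] gives the object of [U] with [o_- = o], [o_+ = o_0]. *)
Program Definition EM_U : TwoSided (EM G) V :=
  {| tob := U_ob; tfun := U_fun; teta := U_eta; tmu := U_mu |}.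
Next Obligation. by destruct a, a', a''; rewrite /= comp_idl comp_idr. Qed.
Next Obligation.
by destruct a, a', a'', a'''; rewrite /= !htens_id !comp_idl !comp_idr.
Qed.
Next Obligation. by destruct a, a'; rewrite /= htens_id !comp_idr. Qed.
Next Obligation. by destruct a, a'; rewrite /= htens_id !comp_idr. Qed.

Inductive R_ob : V -> EM G -> Type := R_obI (o : EM G) : R_ob (g_0 o) o.

Program Definition cofree_ob (o o' : EM G) (x : bhom (g_0 o) (g_0 o')) : EMcoalg o o' :=
  {| em_ob := g_fun o o' x; em_act := g_d x |}.
Next Obligation. exact: g_counit_l. Qed.
Next Obligation. exact: g_coassoc. Qed.

Program Definition cofree (o o' : EM G) : Functor (bhom (g_0 o) (g_0 o')) (bhom o o') :=
  {| fobj := @cofree_ob o o' : bhom (g_0 o) (g_0 o') -> EMhom o o';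
     fmap := fun x y f => {| em_mor := fmap (g_fun o o') f |} |}.
Next Obligation. exact: g_d_nat. Qed.
Next Obligation. apply: EMmor_eq; exact: fmap_id. Qed.
Next Obligation. apply: EMmor_eq; exact: fmap_comp. Qed.

Program Definition cofree_eta (o : EM G) : id1 o ~> cofree o o (id1 (g_0 o)) :=
  {| em_mor := g_eta o |} : EMmor (EM_id o) (cofree_ob (id1 (g_0 o))).
Next Obligation. exact: g_d_eta. Qed.

Program Definition cofree_mu (o o' o'' : EM G) (x' : bhom (g_0 o') (g_0 o''))
    (x : bhom (g_0 o) (g_0 o')) :
    cofree o' o'' x' # cofree o o' x ~> cofree o o'' (x' # x) :=
  {| em_mor := g_mu x' x |} :
    EMmor (EM_tens (cofree_ob x') (cofree_ob x)) (cofree_ob (x' # x)).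
Next Obligation. exact: g_d_mu. Qed.

Definition R_fun (v : V) (o : EM G) (v' : V) (o' : EM G) (a : R_ob v o)
    (a' : R_ob v' o') : Functor (bhom v v') (bhom o o') :=
  match a in R_ob v o, a' in R_ob v' o' return Functor (bhom v v') (bhom o o') with
  | R_obI o, R_obI o' => cofree o o'
  end.

Definition R_eta (v : V) (o : EM G) (a : R_ob v o) : id1 o ~> R_fun a a (id1 v) :=
  match a in R_ob v o return id1 o ~> R_fun a a (id1 v) with
  | R_obI o => cofree_eta o
  end.

Definition R_mu (v : V) (o : EM G) (v' : V) (o' : EM G) (v'' : V) (o'' : EM G)
    (a : R_ob v o) (a' : R_ob v' o') (a'' : R_ob v'' o'') :
    forall (x' : bhom v' v'') (x : bhom v v'),
    R_fun a' a'' x' # R_fun a a' x ~> R_fun a a'' (x' # x) :=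
  match a in R_ob v o, a' in R_ob v' o', a'' in R_ob v'' o''
    return forall (x' : bhom v' v'') (x : bhom v v'),
      R_fun a' a'' x' # R_fun a a' x ~> R_fun a a'' (x' # x) with
  | R_obI o, R_obI o', R_obI o'' => @cofree_mu o o' o''
  end.

(** The right adjoint of [EM_U]: [o_- = o_0] and [o_+ = o]. *)
Program Definition EM_R : TwoSided V (EM G) :=
  {| tob := R_ob; tfun := R_fun; teta := R_eta; tmu := R_mu |}.
Next Obligation. destruct a, a', a''; apply: EMmor_eq; exact: g_mu_nat. Qed.
Next Obligation. destruct a, a', a'', a'''; apply: EMmor_eq; exact: g_mu_ass. Qed.
Next Obligation. destruct a, a'; apply: EMmor_eq; exact: g_mu_lun. Qed.
Next Obligation. destruct a, a'; apply: EMmor_eq; exact: g_mu_run. Qed.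

Program Definition act_mor (o o' : EM G) (x : EMhom o o') :
    x ~> cofree o o' (em_ob x) :=
  {| em_mor := em_act x |} : EMmor x (cofree_ob (em_ob x)).
Next Obligation. exact: em_coassoc. Qed.

Definition unit_ob (o o' : EM G) (a : id_ob o o') : tob (Caten_comp EM_R EM_U) o o' :=
  match a in id_ob o o' return tob (Caten_comp EM_R EM_U) o o' with
  | id_obI o => Cob (g_0 o) (U_obI o) (R_obI o)
  end.

Definition unit_cell (o p o' p' : EM G) (a : id_ob o p) (a' : id_ob o' p') :
    forall x : bhom o o',
    tfun (Caten_id (EM G)) a a' x ~>
    tfun (Caten_comp EM_R EM_U) (unit_ob a) (unit_ob a') x :=
  match a in id_ob o p, a' in id_ob o' p' return forall x : bhom o o',
    tfun (Caten_id (EM G)) a a' x ~>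
    tfun (Caten_comp EM_R EM_U) (unit_ob a) (unit_ob a') x with
  | id_obI o, id_obI o' => @act_mor o o'
  end.

(** The unit of the adjunction, with component [em_act x] at [x]. *)
Program Definition EM_unit : EFun (Caten_id (EM G)) (Caten_comp EM_R EM_U) :=
  {| eob := unit_ob; ecell := unit_cell |}.
Next Obligation. destruct a, a'; apply: EMmor_eq; exact: em_sq. Qed.
Next Obligation.
destruct a, a', a''; apply: EMmor_eq => /=.
by rewrite fmap_id comp_idl comp_idr.
Qed.
Next Obligation.
by destruct a; apply: EMmor_eq; rewrite /= fmap_id comp_idl comp_idr.
Qed.
End ForgetfulAndCofree.

Lemma eq_irr (T : Type) (x y : T) (p q : x = y) : p = q.
Proof. exact: proof_irrelevance. Qed.

Definition tcast (W V : Bicat) (A : TwoSided W V) w v w' v' (a b : tob A w v)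
    (a' b' : tob A w' v') (e : a = b) (e' : a' = b') (x : bhom w w') :
    tfun A a a' x ~> tfun A b b' x :=
  match e in _ = b, e' in _ = b' return tfun A a a' x ~> tfun A b b' x with
  | eq_refl, eq_refl => idm (tfun A a a' x)
  end.

Section Casts.
Context (W V : Bicat) (A : TwoSided W V).

Lemma tcast_id w v w' v' (a : tob A w v) (a' : tob A w' v') (e : a = a)
    (e' : a' = a') (x : bhom w w') : tcast e e' x = idm _.
Proof. by rewrite (eq_irr e eq_refl) (eq_irr e' eq_refl). Qed.

Lemma tcast_ecell (B : TwoSided W V) (F E : EFun A B) w v w' v' (a : tob A w v)
    (a' : tob A w' v') (b : tob B w v) (b' : tob B w' v')
    (e : eob F a = b) (e' : eob F a' = b') (d : eob E a = b) (d' : eob E a' = b')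
    (x : bhom w w') :
  F = E -> tcast e e' x ∘ ecell F a a' x = tcast d d' x ∘ ecell E a a' x.
Proof. by move=> h; subst E; rewrite (eq_irr e d) (eq_irr e' d'). Qed.
End Casts.

Lemma tcast_comp_ecell (W V : Bicat) (A B C : TwoSided W V) (L : EFun B C)
    (D : EFun A B) w v w' v' (a : tob A w v) (a' : tob A w' v') (b : tob B w v)
    (b' : tob B w' v') (c : tob C w v) (c' : tob C w' v')
    (k : eob D a = b) (k' : eob D a' = b') (p : eob L b = c) (p' : eob L b' = c')
    (q : eob (L ⊙ D) a = c) (q' : eob (L ⊙ D) a' = c') (x : bhom w w') :
  (tcast p p' x ∘ ecell L b b' x) ∘ (tcast k k' x ∘ ecell D a a' x) =
  tcast q q' x ∘ ecell (L ⊙ D) a a' x.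
Proof.
subst b b'; rewrite comp_idl -comp_assoc.
by rewrite (eq_irr p q) (eq_irr p' q').
Qed.

Lemma ecell_sig_cast (W V : Bicat) (A B : TwoSided W V) (F E : EFun A B) w v w' v'
    (a : tob A w v) (a' : tob A w' v') (p : eob F a = eob E a)
    (p' : eob F a' = eob E a') (x : bhom w w') :
  tcast p p' x ∘ ecell F a a' x = ecell E a a' x -> ecell_sig F a a' x = ecell_sig E a a' x.
Proof.
rewrite /ecell_sig => <-.
move: (ecell F a a' x); move: (eob E a) (eob E a') p p' => b b' p p' c.
by subst b b'; rewrite comp_idl.
Qed.

Section CastEFun.
Context (W V : Bicat) (A B : TwoSided W V) (D : EFun A B).

Lemma cast_nat w v w' v' (a : tob A w v) (a' : tob A w' v') (b : tob B w v)
    (b' : tob B w' v') (k : eob D a = b) (k' : eob D a' = b') (x y : bhom w w')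
    (p : x ~> y) :
  (tcast k k' y ∘ ecell D a a' y) ∘ fmap (tfun A a a') p =
  fmap (tfun B b b') p ∘ (tcast k k' x ∘ ecell D a a' x).
Proof. by subst b b'; rewrite !comp_idl ecell_nat. Qed.

Lemma cast_mu w v w' v' w'' v'' (a : tob A w v) (a' : tob A w' v')
    (a'' : tob A w'' v'') (b : tob B w v) (b' : tob B w' v') (b'' : tob B w'' v'')
    (k : eob D a = b) (k' : eob D a' = b') (k'' : eob D a'' = b'')
    (x' : bhom w' w'') (x : bhom w w') :
  (tcast k k'' (x' # x) ∘ ecell D a a'' (x' # x)) ∘ tmu A a a' a'' x' x =
  tmu B b b' b'' x' x ∘
    ((tcast k' k'' x' ∘ ecell D a' a'' x') ## (tcast k k' x ∘ ecell D a a' x)).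
Proof. by subst b b' b''; rewrite !comp_idl ecell_mu. Qed.

Lemma cast_eta w v (a : tob A w v) (b : tob B w v) (k : eob D a = b) :
  (tcast k k (id1 w) ∘ ecell D a a (id1 w)) ∘ teta A a = teta B b.
Proof. by subst b; rewrite !comp_idl ecell_eta. Qed.
End CastEFun.

Lemma id_ob_K (V : Bicat) (v : V) (a : id_ob v v) : a = id_obI v.
Proof.
suff h w (b : id_ob v w) (e : w = v) : eq_rect w (id_ob v) b v e = id_obI v.
  exact: (h v a eq_refl).
by destruct b; rewrite (eq_irr e eq_refl).
Qed.

Lemma lunit_cell_cast (X V : Bicat) (A : TwoSided X V) x v x' v'
    (a : tob A x v) (a' : tob A x' v') (r : id_ob v v) (r' : id_ob v' v')
    (K : r = id_obI v) (K' : r' = id_obI v')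
    (p : lunit_ob (Cob v a r) = a) (p' : lunit_ob (Cob v' a' r') = a')
    (f : bhom x x') :
  tcast (A := Caten_id V) K K' (tfun A a a' f) =
  tcast p p' f ∘ lunit_cell (Cob v a r) (Cob v' a' r') f.
Proof. by subst r r'; move: p p' => /= p p'; rewrite !tcast_id comp_idl. Qed.

Lemma runit_cell_cast (X V : Bicat) (A : TwoSided X V) x v x' v'
    (a : tob A x v) (a' : tob A x' v') (r : id_ob x x) (r' : id_ob x' x')
    (K : r = id_obI x) (K' : r' = id_obI x')
    (p : runit_ob (Cob x r a) = a) (p' : runit_ob (Cob x' r' a') = a')
    (f : bhom x x') :
  fmap (tfun A a a') (tcast (A := Caten_id X) K K' f) =
  tcast p p' f ∘ runit_cell (Cob x r a) (Cob x' r' a') f.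
Proof. by subst r r'; move: p p' => /= p p'; rewrite !tcast_id comp_idl fmap_id. Qed.

Definition cpair (X W V : Bicat) (B : TwoSided W V) (A : TwoSided X W) x w v
    (a : tob A x w) (b : tob B w v) : tob (Caten_comp B A) x v := Cob w a b.
Arguments cpair {_ _ _ _ _ _ _ _} _ _ /.

Lemma assoc_cast_r (V : Bicat) (A : TwoSided V V) v v' (a : tob A v v)
    (a' : tob A v' v') (c : tob (Caten_comp A A) v v) (c' : tob (Caten_comp A A) v' v')
    (K : c = cpair a a) (K' : c' = cpair a' a') (f : bhom v v')
    (p : cpair (B := A) (cpair a (lft c)) (rgt c) = cpair (cpair a a) a)
    (p' : cpair (B := A) (cpair a' (lft c')) (rgt c') = cpair (cpair a' a') a') :
  tcast K K' (tfun A a a' f) = tcast p p' f.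
Proof. by subst c c'; rewrite !tcast_id. Qed.

Lemma assoc_cast_l (V : Bicat) (A : TwoSided V V) v v' (a : tob A v v)
    (a' : tob A v' v') (c : tob (Caten_comp A A) v v) (c' : tob (Caten_comp A A) v' v')
    (K : c = cpair a a) (K' : c' = cpair a' a') (f : bhom v v')
    (p : cpair c a = cpair (cpair a a) a) (p' : cpair c' a' = cpair (cpair a' a') a') :
  fmap (tfun A a a') (tcast K K' f) = tcast p p' f.
Proof. by subst c c'; rewrite !tcast_id fmap_id. Qed.

Section Explicit.
Context (V : Bicat) (G : Caten_comonad V).

(** The counit of [G] forces [G_- = G_+] for each object of [G], so the objects
    of [G] over the diagonal are all of them, and [G_0] is the first component. *)
Definition x_ob : Type := {v : V & tob G v v}.
Definition x_0 (o : x_ob) : V := projT1 o.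
Definition x_tob (o : x_ob) : tob G (x_0 o) (x_0 o) := projT2 o.

Lemma x_e_ob (o : x_ob) : eob (cc_e G) (x_tob o) = id_obI (x_0 o).
Proof. exact: id_ob_K. Qed.

Lemma EFun_ob (W U : Bicat) (A B : TwoSided W U) (F E : EFun A B) w u
    (a : tob A w u) : F = E -> eob F a = eob E a.
Proof. by move=> ->. Qed.

Lemma x_d_ob (o : x_ob) :
  eob (cc_d G) (x_tob o) =
  cpair (x_tob o) (x_tob o).
Proof.
case: o => v g; rewrite /x_tob /x_0 /=.
have := EFun_ob g (cc_counit_l G); have := EFun_ob g (cc_counit_r G) => /=.
rewrite /lunit_ob /runit_ob /=.
case: (eob (cc_d G) g) => u l r /=.
have e : u = v by case: (eob (cc_e G) r).
subst u.
rewrite (id_ob_K (eob (cc_e G) l)) (id_ob_K (eob (cc_e G) r)).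
by move=> -> ->.
Qed.

Definition x_fun (o o' : x_ob) := tfun G (x_tob o) (x_tob o').

Definition x_e (o o' : x_ob) (x : bhom (x_0 o) (x_0 o')) : x_fun o o' x ~> x :=
  tcast (A := Caten_id V) (x_e_ob o) (x_e_ob o') x ∘
    ecell (cc_e G) (x_tob o) (x_tob o') x.

Definition x_d (o o' : x_ob) (x : bhom (x_0 o) (x_0 o')) :
    x_fun o o' x ~> x_fun o o' (x_fun o o' x) :=
  tcast (A := Caten_comp G G) (x_d_ob o) (x_d_ob o') x ∘
    ecell (cc_d G) (x_tob o) (x_tob o') x.

Lemma x_counit_l (o o' : x_ob) (x : bhom (x_0 o) (x_0 o')) :
  x_e (x_fun o o' x) ∘ x_d x = idm (x_fun o o' x).
Proof.
pose L := lunit G ⊙ whisk_r (cc_e G) G.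
have p (q : x_ob) : eob L (cpair (x_tob q) (x_tob q)) = x_tob q.
  by rewrite /L /= (x_e_ob q).
have p2 (q : x_ob) : eob (L ⊙ cc_d G) (x_tob q) = x_tob q.
  exact: eq_trans (f_equal (fun c => eob L c) (x_d_ob q)) (p q).
have -> : x_e (x_fun o o' x) =
    tcast (p o) (p o') x ∘ ecell L (cpair (x_tob o) (x_tob o))
      (cpair (x_tob o') (x_tob o')) x.
  by rewrite /x_e (lunit_cell_cast _ _ (p o) (p o')) /L /= comp_assoc.
have e : L ⊙ cc_d G = EFun_id G by rewrite /L -EFun_comp_assoc cc_counit_l.
rewrite (tcast_comp_ecell (x_d_ob o) (x_d_ob o') (p o) (p o') (p2 o) (p2 o')).
by rewrite (tcast_ecell _ _ eq_refl eq_refl _ e) /= comp_idl.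
Qed.

Lemma x_counit_r (o o' : x_ob) (x : bhom (x_0 o) (x_0 o')) :
  fmap (x_fun o o') (x_e x) ∘ x_d x = idm (x_fun o o' x).
Proof.
pose L := runit G ⊙ whisk_l G (cc_e G).
have p (q : x_ob) : eob L (cpair (x_tob q) (x_tob q)) = x_tob q.
  by rewrite /L /= (x_e_ob q).
have p2 (q : x_ob) : eob (L ⊙ cc_d G) (x_tob q) = x_tob q.
  exact: eq_trans (f_equal (fun c => eob L c) (x_d_ob q)) (p q).
have -> : fmap (x_fun o o') (x_e x) =
    tcast (p o) (p o') x ∘ ecell L (cpair (x_tob o) (x_tob o))
      (cpair (x_tob o') (x_tob o')) x.
  by rewrite /x_e fmap_comp (runit_cell_cast _ _ (p o) (p o')) /L /= comp_assoc.
have e : L ⊙ cc_d G = EFun_id G by rewrite /L -EFun_comp_assoc cc_counit_r.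
rewrite (tcast_comp_ecell (x_d_ob o) (x_d_ob o') (p o) (p o') (p2 o) (p2 o')).
by rewrite (tcast_ecell _ _ eq_refl eq_refl _ e) /= comp_idl.
Qed.

Lemma x_coassoc (o o' : x_ob) (x : bhom (x_0 o) (x_0 o')) :
  x_d (x_fun o o' x) ∘ x_d x = fmap (x_fun o o') (x_d x) ∘ x_d x.
Proof.
pose L := assoc G G G ⊙ whisk_r (cc_d G) G.
pose R := whisk_l G (cc_d G).
pose b (q : x_ob) := cpair (x_tob q) (x_tob q).
pose t (q : x_ob) := cpair (b q) (x_tob q).
have p (q : x_ob) : eob L (b q) = t q by rewrite /L /= (x_d_ob q).
have p2 (q : x_ob) : eob (L ⊙ cc_d G) (x_tob q) = t q.
  exact: eq_trans (f_equal (fun c => eob L c) (x_d_ob q)) (p q).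
have r (q : x_ob) : eob R (b q) = t q by rewrite /R /= (x_d_ob q).
have r2 (q : x_ob) : eob (R ⊙ cc_d G) (x_tob q) = t q.
  exact: eq_trans (f_equal (fun c => eob R c) (x_d_ob q)) (r q).
have -> : x_d (x_fun o o' x) = tcast (p o) (p o') x ∘ ecell L (b o) (b o') x.
  by rewrite /x_d (assoc_cast_r _ _ _ (p o) (p o')) /L /= comp_idl.
have -> : fmap (x_fun o o') (x_d x) = tcast (r o) (r o') x ∘ ecell R (b o) (b o') x.
  by rewrite /x_d fmap_comp (assoc_cast_l _ _ _ (r o) (r o')).
have e : L ⊙ cc_d G = R ⊙ cc_d G by rewrite /L -EFun_comp_assoc cc_coassoc.
rewrite (tcast_comp_ecell (x_d_ob o) (x_d_ob o') (p o) (p o') (p2 o) (p2 o')).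
rewrite (tcast_comp_ecell (x_d_ob o) (x_d_ob o') (r o) (r o') (r2 o) (r2 o')).
exact: (tcast_ecell (p2 o) (p2 o') (r2 o) (r2 o') x e).
Qed.

Program Definition explicit : Comonad V :=
  {| g_ob := x_ob; g_0 := x_0; g_fun := x_fun;
     g_eta := fun o => teta G (x_tob o);
     g_mu := fun o o' o'' x' x => tmu G (x_tob o) (x_tob o') (x_tob o'') x' x;
     g_d := x_d; g_e := x_e |}.
Next Obligation. exact: tmu_nat. Qed.
Next Obligation. exact: tmu_ass. Qed.
Next Obligation. exact: tmu_lun. Qed.
Next Obligation. exact: tmu_run. Qed.
Next Obligation. exact: (cast_nat (x_d_ob o) (x_d_ob o') p). Qed.
Next Obligation. exact: (cast_nat (x_e_ob o) (x_e_ob o') p). Qed.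
Next Obligation. exact: x_counit_l. Qed.
Next Obligation. exact: x_counit_r. Qed.
Next Obligation. exact: x_coassoc. Qed.
Next Obligation.
apply: eq_trans (cast_mu (x_e_ob o) (x_e_ob o') (x_e_ob o'') x' x) _; exact: comp_idl.
Qed.
Next Obligation. exact: (cast_eta (x_e_ob o)). Qed.
Next Obligation.
apply: eq_trans (cast_mu (x_d_ob o) (x_d_ob o') (x_d_ob o'') x' x) _.
by rewrite /= -comp_assoc.
Qed.
Next Obligation. exact: (cast_eta (x_d_ob o)). Qed.

Definition UR_ob v v' (c : tob (Caten_comp (EM_U explicit) (EM_R explicit)) v v') :
    tob G v v' :=
  match lft c in R_ob v o return U_ob o v' -> tob G v v' with
  | R_obI o => fun u =>
    match u in U_ob o v' return tob G (x_0 o) v' with U_obI o => x_tob o end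
  end (rgt c).

Definition UR_cell v w v' w'
    (c : tob (Caten_comp (EM_U explicit) (EM_R explicit)) v w)
    (c' : tob (Caten_comp (EM_U explicit) (EM_R explicit)) v' w') : forall x : bhom v v',
    tfun (Caten_comp (EM_U explicit) (EM_R explicit)) c c' x ~>
    tfun G (UR_ob c) (UR_ob c') x :=
  match lft c as r in R_ob v o, lft c' as r' in R_ob v' o'
    return forall (u : U_ob o w) (u' : U_ob o' w') (x : bhom v v'),
      tfun (Caten_comp (EM_U explicit) (EM_R explicit)) (Cob o r u) (Cob o' r' u') x ~>
      tfun G (UR_ob (Cob o r u)) (UR_ob (Cob o' r' u')) x with
  | R_obI o, R_obI o' => fun u u' =>
    match u as u in U_ob o w, u' as u' in U_ob o' w'
      return forall x : bhom (x_0 o) (x_0 o'),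
        tfun (Caten_comp (EM_U explicit) (EM_R explicit))
          (Cob o (R_obI (G := explicit) o) u) (Cob o' (R_obI (G := explicit) o') u') x ~>
        tfun G (UR_ob (Cob o (R_obI (G := explicit) o) u))
          (UR_ob (Cob o' (R_obI (G := explicit) o') u')) x with
    | U_obI o, U_obI o' => fun x => idm (x_fun o o' x)
    end
  end (rgt c) (rgt c').

Ltac split_UR c :=
  let r := fresh in let u := fresh in destruct c as [? r u]; destruct r; destruct u.

(** [U ∘ R] is [G], with identity cells. *)
Program Definition UR : EFun (Caten_comp (EM_U explicit) (EM_R explicit)) G :=
  {| eob := UR_ob; ecell := UR_cell |}.
Next Obligation.
by split_UR a; split_UR a'; rewrite /= comp_idl comp_idr.
Qed.
Next Obligation.
by split_UR a; split_UR a'; split_UR a''; rewrite /= htens_id !comp_idl !comp_idr.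
Qed.
Next Obligation. by split_UR a; rewrite /= comp_idl comp_idr. Qed.

Definition EM_act : EFun (EM_U explicit) (Caten_comp G (EM_U explicit)) :=
  whisk_r UR (EM_U explicit) ⊙ assocV (EM_U explicit) (EM_R explicit) (EM_U explicit) ⊙
    whisk_l (EM_U explicit) (EM_unit explicit) ⊙ runitV (EM_U explicit).

Definition x_U (o : x_ob) : tob (EM_U explicit) o (x_0 o) := U_obI (G := explicit) o.

Lemma x_U_cast (o o' : x_ob) (c : tob (Caten_comp G G) (x_0 o) (x_0 o))
    (c' : tob (Caten_comp G G) (x_0 o') (x_0 o'))
    (K : c = cpair (x_tob o) (x_tob o)) (K' : c' = cpair (x_tob o') (x_tob o'))
    (x : EMhom (G := explicit) o o')
    (p : cpair (cpair (x_U o) (lft c)) (rgt c) =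
      cpair (cpair (x_U o) (x_tob o)) (x_tob o))
    (p' : cpair (cpair (x_U o') (lft c')) (rgt c') =
      cpair (cpair (x_U o') (x_tob o')) (x_tob o')) :
  tcast p p' (x : bhom (o : EM explicit) (o' : EM explicit)) = tcast K K' (em_ob x).
Proof. by subst c c'; rewrite !tcast_id. Qed.

(** The coaction [U ∘ g : U -> U ∘ R ∘ U = G ∘ U]. *)
Program Definition EM_coaction : Caten_coaction G (EM_U explicit) :=
  {| ck_act := EM_act |}.
Next Obligation.
apply: EFun_ext => o v o' v' a a' x; destruct a, a'.
pose F := lunit (EM_U explicit) ⊙ whisk_r (cc_e G) (EM_U explicit) ⊙ EM_act.
have p (q : x_ob) : eob F (x_U q) = x_U q by rewrite /F /= (x_e_ob q).
refine (@ecell_sig_cast _ _ _ _ F (EFun_id _) _ _ _ _ (x_U o) (x_U o0) (p o) (p o0) x _).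
transitivity (x_e (em_ob x) ∘ em_act x); last exact: em_counit.
rewrite /F /x_e /= !comp_idr !comp_idl !comp_assoc; congr (_ ∘ _); congr (_ ∘ _).
symmetry.
exact: (lunit_cell_cast (A := EM_U explicit) (x_e_ob o) (x_e_ob o0) (p o) (p o0) x).
Qed.
Next Obligation.
apply: EFun_ext => o v o' v' a a' x; destruct a, a'.
pose F := assoc G G (EM_U explicit) ⊙ whisk_r (cc_d G) (EM_U explicit) ⊙ EM_act.
pose E := whisk_l G EM_act ⊙ EM_act.
have p (q : x_ob) : eob F (x_U q) = eob E (x_U q) by rewrite /F /= (x_d_ob q).
refine (@ecell_sig_cast _ _ _ _ F E _ _ _ _ (x_U o) (x_U o0) (p o) (p o0) x _).
transitivity (x_d (em_ob x) ∘ em_act x).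
  rewrite /F /x_d /= !comp_idr !comp_idl !comp_assoc; congr (_ ∘ _); congr (_ ∘ _).
  exact: x_U_cast.
by rewrite /E /= !comp_idr !comp_idl; exact: em_coassoc.
Qed.
End Explicit.

(* Main.v *)
(** The comparison 2-functor is bijective on 1-cells and on 2-cells and hits every
    coalgebra up to isomorphism. The objects of [U ∘ A] are those of [A], and the
    coaction on [U ∘ A] pairs an object [a] with [a_+], an object of [G]; so a
    morphism of coalgebras [U ∘ A -> U ∘ B] preserves [a_+], and the condition on
    its cells says that they are morphisms of Eilenberg-Moore coalgebras. A
    coalgebra [α : A -> G ∘ A] has [α a = (a, g)] by the counit law; taking [g] as
    [a_+] and the cells of [α] as coactions lifts [A] to [V^G]. *)

From Corelib Require Import ssreflect.
From Stdlib Require Import ProofIrrelevance IndefiniteDescription.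
Require Import Defs.

Set Implicit Arguments.
Unset Strict Implicit.
Unset Printing Implicit Defensive.
#[local] Obligation Tactic := intros; simpl in *.

(** * Equivalences of 2-categories from isomorphisms on hom categories *)

Section LocalIsomorphism.
Context (K L : TwoCat) (T : TwoFunctor K L).
Hypothesis F1_inj : forall (a b : K) (f f' : c1 a b), F1 T f = F1 T f' -> f = f'.
Hypothesis F1_surj : forall (a b : K) (g : c1 (T a) (T b)), exists f, F1 T f = g.
Hypothesis F2_inj : forall (a b : K) (f f' : c1 a b) (p q : f ~> f'),
  F2 T p = F2 T q -> p = q.
Hypothesis F2_surj : forall (a b : K) (f f' : c1 a b) (q : F1 T f ~> F1 T f'),
  exists p, F2 T p = q.
Hypothesis eso : forall b : L, exists (a : K) (j : c1 (T a) b), is_iso1 j.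

(** Equality under [arr] includes equality of the boundaries, which [F1_inj] reflects before
    [F2_inj] applies. *)
Lemma F2_arr_inj (a b : K) (f f' g g' : c1 a b) (p : f ~> f') (q : g ~> g') :
  arr (F2 T p) = arr (F2 T q) -> arr p = arr q.
Proof.
move=> e; case: (arr_bd e) => /F1_inj e1 /F1_inj e2; subst g g'.
by congr arr; apply: F2_inj; apply: arr_inj.
Qed.

Lemma F2_arr_surj (a b : K) (f f' : c1 a b) (g g' : c1 (T a) (T b)) (q : g ~> g') :
  F1 T f = g -> F1 T f' = g' -> exists p : f ~> f', arr (F2 T p) = arr q.
Proof.
by move=> e e'; subst g g'; case: (F2_surj q) => p <-; exists p.
Qed.

(** The inverse conjugates by chosen isomorphisms [T (S0 b) ≅ b] and takes preimages under [T]; its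
    laws are checked after applying [T], which reflects equalities. *)
Lemma local_iso_is_2equivalence : is_2equivalence T.
Proof.
(* A 2-functor is data, so the preimages have to be picked by indefinite description. *)
have inv0 b : {a : K & {jk : c1 (T a) b * c1 b (T a) |
    snd jk • fst jk = cid (T a) /\ fst jk • snd jk = cid b}}.
  have [a h] := constructive_indefinite_description _ (eso b).
  exists a; apply: constructive_indefinite_description.
  by case: h => j [k e]; exists (j, k).
pose S0 b := projT1 (inv0 b).
pose j b : c1 (T (S0 b)) b := fst (proj1_sig (projT2 (inv0 b))).
pose k b : c1 b (T (S0 b)) := snd (proj1_sig (projT2 (inv0 b))).
have kj b : k b • j b = cid _ by exact: proj1 (proj2_sig (projT2 (inv0 b))).
have jk b : j b • k b = cid _ by exact: proj2 (proj2_sig (projT2 (inv0 b))).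
have inv1 a b (g : c1 (T a) (T b)) : {f | F1 T f = g}.
  exact: constructive_indefinite_description (F1_surj g).
pose R1 a b (g : c1 (T a) (T b)) := proj1_sig (inv1 a b g).
have R1K a b (g : c1 (T a) (T b)) : F1 T (R1 a b g) = g.
  exact: proj2_sig (inv1 a b g).
have inv2 a b (g g' : c1 (T a) (T b)) (q : g ~> g') :
    {p : R1 a b g ~> R1 a b g' | arr (F2 T p) = arr q}.
  exact: constructive_indefinite_description (F2_arr_surj q (R1K _ _ g) (R1K _ _ g')).
pose R2 a b (g g' : c1 (T a) (T b)) (q : g ~> g') := proj1_sig (inv2 a b g g' q).
have R2K a b (g g' : c1 (T a) (T b)) (q : g ~> g') : arr (F2 T (R2 _ _ _ _ q)) = arr q.
  exact: proj2_sig (inv2 a b g g' q).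
(* From here on the chosen data enter only through [kj], [jk], [R1K] and [R2K]. *)
clearbody S0 j k R1 R2; clear inv0 inv1 inv2.
pose S1 b c (g : c1 b c) : c1 (S0 b) (S0 c) := R1 _ _ (k c • g • j b).
pose S2 b c (g g' : c1 b c) (q : g ~> g') : S1 b c g ~> S1 b c g' :=
  R2 _ _ _ _ (idm (k c) ★ q ★ idm (j b)).
have S1K b c (g : c1 b c) : F1 T (S1 b c g) = k c • g • j b by exact: R1K.
have S2K b c (g g' : c1 b c) (q : g ~> g') :
  arr (F2 T (S2 b c g g' q)) = arr (idm (k c) ★ q ★ idm (j b)) by exact: R2K.
clearbody S1 S2.
have S2id b c (g : c1 b c) : S2 b c g g (idm g) = idm (S1 b c g).
  apply: arr_inj; apply: F2_arr_inj; rewrite S2K !hcomp_id /F2 fmap_id.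
  by apply: arr_id; rewrite S1K.
have S2comp b c (g g' g'' : c1 b c) (q' : g' ~> g'') (q : g ~> g') :
    S2 b c g g'' (q' ∘ q) = S2 b c g' g'' q' ∘ S2 b c g g' q.
  apply: arr_inj; apply: F2_arr_inj; rewrite S2K /F2 fmap_comp.
  rewrite -{1}(comp_idl (idm (k c))) -(comp_idl (idm (j b))) !hcomp_comp.
  by apply: arr_comp; symmetry; exact: S2K.
pose S1F b c : Functor (c1 b c) (c1 (S0 b) (S0 c)) :=
  Build_Functor (@S2id b c) (@S2comp b c).
have S_id b : S1F b b (cid b) = cid (S0 b).
  by apply: F1_inj; rewrite S1K F1_id ccomp_idl kj.
have S_comp b c d (h : c1 c d) (g : c1 b c) : S1F b d (h • g) = S1F c d h • S1F b c g.
  apply: F1_inj; rewrite F1_comp !S1K -!ccomp_assoc; congr (_ • _); congr (_ • _).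
  by rewrite (ccomp_assoc (j c)) jk ccomp_idl.
have S_comp2 b c d (h h' : c1 c d) (g g' : c1 b c) (r : h ~> h') (q : g ~> g') :
    arr (fmap (S1F b d) (r ★ q)) = arr (fmap (S1F c d) r ★ fmap (S1F b c) q).
  apply: F2_arr_inj; rewrite S2K; symmetry.
  transitivity (arr (F2 T (S2 _ _ _ _ r) ★ F2 T (S2 _ _ _ _ q))).
    exact: F2_comp.
  transitivity (arr ((idm (k d) ★ r ★ idm (j c)) ★ (idm (k c) ★ q ★ idm (j b)))).
    by apply: arr_hcomp; exact: S2K.
  rewrite -!hcomp_assoc; apply: arr_hcomp => //.
  rewrite -!hcomp_assoc; apply: arr_hcomp => //.
  rewrite (hcomp_assoc (idm (j c))) hcomp_id jk.
  by rewrite hcomp_idl.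
pose S : TwoFunctor L K := Build_TwoFunctor S_id S_comp S_comp2.
(* The unit at [a] is the preimage of [k (T a)]; its naturality and invertibility reduce to [jk] and
   [kj]. *)
pose i0 a : c1 a (S (T a)) := R1 a (S0 (T a)) (k (T a)).
have i0K a : F1 T (i0 a) = k (T a) by exact: R1K.
pose i0V a : c1 (S (T a)) a := R1 (S0 (T a)) a (j (T a)).
have i0VK a : F1 T (i0V a) = j (T a) by exact: R1K.
have i1 a b (f : c1 a b) : F1 (TwoFunctor_comp S T) f • i0 a = i0 b • f.
  by apply: F1_inj; rewrite !F1_comp S1K !i0K -!ccomp_assoc jk ccomp_idr.
have i2 a b (f f' : c1 a b) (p : f ~> f') :
    arr (F2 (TwoFunctor_comp S T) p ★ idm (i0 a)) = arr (idm (i0 b) ★ p).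
  apply: F2_arr_inj.
  transitivity (arr (F2 T (F2 S (F2 T p)) ★ F2 T (idm (i0 a)))); first exact: F2_comp.
  transitivity (arr (F2 T (idm (i0 b)) ★ F2 T p)); last by symmetry; exact: F2_comp.
  rewrite /F2 !fmap_id !i0K.
  transitivity (arr ((idm (k (T b)) ★ F2 T p ★ idm (j (T a))) ★ idm (k (T a)))).
    by apply: arr_hcomp => //; exact: S2K.
  by rewrite -hcomp_assoc; apply: arr_hcomp => //; rewrite -hcomp_assoc hcomp_id jk hcomp_idr.
have j1 b c (g : c1 b c) : g • j b = j c • F1 (TwoFunctor_comp T S) g.
  by rewrite /= S1K ccomp_assoc jk ccomp_idl.
have j2 b c (g g' : c1 b c) (q : g ~> g') :
    arr (q ★ idm (j b)) = arr (idm (j c) ★ F2 (TwoFunctor_comp T S) q).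
  symmetry; transitivity (arr (idm (j c) ★ idm (k c) ★ q ★ idm (j b))).
    by apply: arr_hcomp => //; exact: S2K.
  by rewrite hcomp_assoc hcomp_id jk hcomp_idl.
exists S.
exists (@Build_TwoNat _ _ (TwoFunctor_id K) (TwoFunctor_comp S T) i0 i1 i2).
exists (@Build_TwoNat _ _ (TwoFunctor_comp T S) (TwoFunctor_id L) j j1 j2).
split=> [a|b]; last by exists (k b); split; [exact: kj|exact: jk].
exists (i0V a); split.
  by apply: F1_inj (_ : F1 T (i0V a • i0 a) = F1 T (cid a)); rewrite F1_comp F1_id i0K i0VK jk.
by apply: F1_inj (_ : F1 T (i0 a • i0V a) = F1 T (cid (S0 (T a)))); rewrite F1_comp F1_id i0K i0VK kj.
Qed.
End LocalIsomorphism.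

(** * Isomorphisms of coalgebras, components of 2-cells and of pairs *)

Lemma coalg_iso (K : TwoCat) (T : TwoComonad K) (a b : Coalg T) (j : CoalgMor a b)
    (k : c1 (co_ob b) (co_ob a)) :
  k • cm_mor j = cid _ -> cm_mor j • k = cid _ ->
  is_iso1 (j : c1 (a : CoalgTwoCat T) (b : CoalgTwoCat T)).
Proof.
move=> kj jk.
(* Composing the square of [j] with the inverse on both sides gives the square of [k]. *)
have sq : F1 T k • co_act b = co_act a • k.
  rewrite -(ccomp_idr (co_act b)) -jk (ccomp_assoc (co_act b)) -cm_sq.
  by rewrite -ccomp_assoc ccomp_assoc -F1_comp kj F1_id ccomp_idl.
by exists (Build_CoalgMor sq); split; apply: CoalgMor_eq.
Qed.

(** A converse of [arr_Tricell], which lets the condition on a coalgebra 2-cell be read one object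
    at a time. *)
Lemma arr_tcell (W V : Bicat) (A B : TwoSided W V) (F E F' E' : Caten_hom A B)
    (p : F ~> E) (p' : F' ~> E') w v (a : tob A w v) :
  arr p = arr p' ->
  existT (fun b : tob B w v * tob B w v =>
            id1 v ~> tfun B (fst b) (snd b) (id1 w)) (eob F a, eob E a) (tcell p a) =
  existT (fun b : tob B w v * tob B w v =>
            id1 v ~> tfun B (fst b) (snd b) (id1 w)) (eob F' a, eob E' a) (tcell p' a).
Proof.
move=> e; case: (arr_bd e) => e1 e2; subst F' E'.
by rewrite (arr_inj e).
Qed.

Lemma Cob_inj (T : Type) (P Q : T -> Type) (m : T) (l l' : P m) (r r' : Q m) :
  Cob (P := P) (Q := Q) m l r = Cob m l' r' -> l = l' /\ r = r'.
Proof.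
move=> e.
by split; apply: inj_pair2;
  [exact: (f_equal (fun c => existT P (mid c) (lft c)) e)
  |exact: (f_equal (fun c => existT Q (mid c) (rgt c)) e)].
Qed.

(** * The objects of [U ∘ A] and the injectivity of the comparison *)

Section LiftToCoalgebras.
Context (V : Bicat) (G : Caten_comonad V) (X : Bicat).

Local Notation E := (EM (explicit G)).
Local Notation U := (EM_U (explicit G)).
Local Notation k := (postcomp_coaction X (EM_coaction G)).
Local Notation T := (comparison k).

(** Destructing the [U_ob] component puts every object of [U ∘ A] in this form, so this is the
    bijection between the objects of [A] and those of [U ∘ A]. *)
Definition over (A : TwoSided X E) x (o : x_ob G) (a : tob A x o) :
    tob (Caten_comp U A) x (x_0 o) :=
  Cob (o : E) a (x_U o).

Lemma over_inj (B : TwoSided X E) x (o : x_ob G) (b c : tob B x o) :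
  over b = over c -> b = c.
Proof. by move=> h; exact: proj1 (Cob_inj h). Qed.

(** A morphism of Eilenberg-Moore coalgebras is determined by its underlying 2-cell; the boundaries
    come along because [EFun_ext] compares cells through [ecell_sig]. *)
Lemma over_sig_inj (B : TwoSided X E) x (o : x_ob G) x' (o' : x_ob G)
    (b c : tob B x o) (b' c' : tob B x' o') (f : bhom x x') (y : EMhom (G := explicit G) o o')
    (p : EMmor y (tfun B b b' f)) (q : EMmor y (tfun B c c' f)) :
  existT (fun s : tob (Caten_comp U B) x (x_0 o) * tob (Caten_comp U B) x' (x_0 o') =>
      em_ob y ~> tfun (Caten_comp U B) (fst s) (snd s) f) (over b, over b') (em_mor p) =
  existT _ (over c, over c') (em_mor q) ->
  existT (fun s : tob B x o * tob B x' o' => EMmor y (tfun B (fst s) (snd s) f))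
    (b, b') p = existT _ (c, c') q.
Proof.
move=> h.
have e : b = c by apply: over_inj; exact: (f_equal (fun s => fst (projT1 s)) h).
have e' : b' = c' by apply: over_inj; exact: (f_equal (fun s => snd (projT1 s)) h).
subst c c'; congr existT; apply: EMmor_eq.
exact: inj_pair2 _ _ _ _ _ h.
Qed.

Lemma comparison_F1_inj (A B : Caten X E) (F F' : c1 A B) :
  F1 T F = F1 T F' -> F = F'.
Proof.
move=> e; have {}e : whisk_l U F = whisk_l U F' by exact: (f_equal (@cm_mor _ _ _ _) e).
apply: EFun_ext => x o x' o' a a' f; apply: over_sig_inj.
exact: (f_equal (fun H => ecell_sig H (over a) (over a') f) e).
Qed.

(** The units of [U] are identities, so whiskering with [U] only forgets the compatibility with
    coactions. *)
Lemma whisk_cell_over (A B : TwoSided X E) (F F' : EFun A B) (p : Tricell F F') x o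
    (a : tob A x o) : tcell (whisk_cell U p) (over a) = em_mor (tcell p a).
Proof. exact: comp_idr. Qed.

Lemma comparison_F2_inj (A B : Caten X E) (F F' : c1 A B) (p q : F ~> F') :
  F2 T p = F2 T q -> p = q.
Proof.
move=> e; have {}e : whisk_cell U p = whisk_cell U q by exact: (f_equal (@cc_cell _ _ _ _ _ _) e).
apply: Tricell_eq => x o a; apply: EMmor_eq.
by rewrite -!whisk_cell_over e.
Qed.

(** * Surjectivity of the comparison on 2-cells *)

Lemma em_mor_actl (B : TwoSided X E) x (o : x_ob G) x' (o' : x_ob G) (a : tob B x o)
    (b b' : tob B x' o') (f : bhom x x') (s : EMhom (G := explicit G) o o')
    (p : EMmor (EM_id (G := explicit G) o') (tfun B b b' (id1 x')))
    (g : EMmor s (tfun B a b f)) :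
  em_mor (actl (B := B) (s := s) p g) =
  actl (B := Caten_comp U B) (a := over a) (b := over b) (b' := over b')
    (em_mor p) (em_mor g).
Proof.
(* The identity introduced here is [teta] of [U], which [comp_actl] expects next to [em_mor p]. *)
rewrite -[em_mor p]comp_idr.
by symmetry; exact: (comp_actl (B := U) (A := B) (x_U o) (x_U o') p g).
Qed.

Lemma em_mor_actr (B : TwoSided X E) x (o : x_ob G) x' (o' : x_ob G) (a a' : tob B x o)
    (b : tob B x' o') (f : bhom x x') (s : EMhom (G := explicit G) o o')
    (g : EMmor s (tfun B a' b f))
    (p : EMmor (EM_id (G := explicit G) o) (tfun B a a' (id1 x))) :
  em_mor (actr (B := B) (s := s) g p) =
  actr (B := Caten_comp U B) (a := over a) (a' := over a') (b := over b)
    (em_mor g) (em_mor p).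
Proof.
rewrite -[em_mor p]comp_idr.
by symmetry; exact: (comp_actr (B := U) (A := B) (x_U o) (x_U o') g p).
Qed.

(** The coaction pairs [over a] with [x_tob o], so the condition on [q] at [over a] says that this
    component is a morphism of coalgebras out of the identity [(1, η)]. *)
Lemma coalg_cell_sq (A B : Caten X E) (F F' : c1 A B) (q : F1 T F ~> F1 T F')
    x (o : x_ob G) (a : tob A x o) :
  em_act (G := explicit G) (tfun B (eob F a) (eob F' a) (id1 x)) ∘
    tcell (cc_cell q) (over a) =
  fmap (x_fun o o) (tcell (cc_cell q) (over a)) ∘ teta G (x_tob o).
Proof.
(* At [over a] both boundaries compute to the same pair of objects, so no transport remains. *)
have sq := inj_pair2 _ _ _ _ _ (arr_tcell (over a) (cc_sq q)).
move: sq; rewrite Caten_hcomp_idr Caten_hcomp_idl /= !comp_idl comp_idr => sq.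
by symmetry.
Qed.

(** The components of [q] are Eilenberg-Moore morphisms by [coalg_cell_sq]; naturality is checked on
    underlying 2-cells, since forgetting coactions respects [actl] and [actr]. *)
Lemma comparison_F2_surj (A B : Caten X E) (F F' : c1 A B) (q : F1 T F ~> F1 T F') :
  exists p, F2 T p = q.
Proof.
pose cell x o (a : tob A x o) : EMmor (EM_id (G := explicit G) o)
    (tfun B (eob F a) (eob F' a) (id1 x)) :=
  {| em_mor := tcell (cc_cell q) (over a) : em_ob (EM_id o) ~> _;
     em_sq := coalg_cell_sq q a |}.
have nat x o x' o' (a : tob A x o) (a' : tob A x' o') (f : bhom x x') :
    actl (B := B) (cell _ _ a') (ecell F a a' f) =
    actr (B := B) (ecell F' a a' f) (cell _ _ a).
  apply: EMmor_eq; rewrite em_mor_actl em_mor_actr.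
  exact: (tcell_nat (cc_cell q) (over a) (over a') f).
exists (Build_Tricell nat : (F : Caten_hom A B) ~> F').
apply: CoalgCell_eq; apply: Tricell_eq => x v [o a u]; destruct u.
exact: whisk_cell_over.
Qed.

(** * Surjectivity of the comparison on 1-cells *)

Lemma ecell_tcast (W W' : Bicat) (A B : TwoSided W W') (F : EFun A B) w v w' v'
    (a b : tob A w v) (a' b' : tob A w' v') (e : a = b) (e' : a' = b')
    (d : eob F a = eob F b) (d' : eob F a' = eob F b') (f : bhom w w') :
  ecell F b b' f ∘ tcast e e' f = tcast d d' f ∘ ecell F a a' f.
Proof. by subst b b'; rewrite !tcast_id comp_idl comp_idr. Qed.

Lemma fmap_tcast (W : Bicat) (C : TwoSided W V) (A : TwoSided X W) x w x' w' v v'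
    (a b : tob A x w) (a' b' : tob A x' w') (c : tob C w v) (c' : tob C w' v')
    (e : a = b) (e' : a' = b') (p : cpair a c = cpair b c)
    (p' : cpair a' c' = cpair b' c') (f : bhom x x') :
  fmap (tfun C c c') (tcast e e' f) = tcast (A := Caten_comp C A) p p' f.
Proof. by subst b b'; rewrite !tcast_id fmap_id. Qed.

(** This is the coaction that the comparison puts on [U ∘ A], isolated from the surrounding
    records. *)
Definition cofree_act (A : TwoSided X E) :
    EFun (Caten_comp U A) (Caten_comp G (Caten_comp U A)) :=
  assoc G U A ⊙ whisk_r (EM_act G) A.

(** Every factor except [EM_unit] has identity cells, and [EM_unit] contributes the coaction. *)
Lemma ecell_cofree_act (A : TwoSided X E) x (o : x_ob G) x' (o' : x_ob G)
    (a : tob A x o) (a' : tob A x' o') (f : bhom x x') :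
  ecell (cofree_act A) (over a) (over a') f = em_act (G := explicit G) (tfun A a a' f).
Proof. by rewrite /= !comp_idl comp_idr. Qed.

(** The coaction pairs [c] with the object of [G] carried by [mid c]; if that object is [g], then
    [mid c] is [(v, g)]. This is why morphisms of coalgebras preserve boundaries in [V^G]. *)
Lemma over_of_act (B : TwoSided X E) x v (c : tob (Caten_comp U B) x v) (g : tob G v v) :
  cpair c g = eob (cofree_act B) c ->
  {b : tob B x (existT (fun u : V => tob G u u) v g : x_ob G) | c = over b}.
Proof.
case: c => -[v' g'] b u; move: g.
(* The match abstracts over [b] and [g] too, since their types depend on the indices of [u]. *)
refine (match u in U_ob o v return forall (b : tob B x o) (g : tob G v v),
  cpair (B := G) (Cob o b u : tob (Caten_comp U B) x v) g =
    eob (cofree_act B) (Cob o b u) ->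
  {b' : tob B x (existT (fun u : V => tob G u u) v g : x_ob G) | Cob o b u = over b'} with
  U_obI o => _ end b).
move=> {u b} {}b {}g h.
have e : g = x_tob o by exact: proj2 (Cob_inj h).
by subst g; case: o b h => v1 g1 b _; exists b.
Qed.

Section LiftMorphism.
Context (A B : TwoSided X E) (H : EFun (Caten_comp U A) (Caten_comp U B)).
Hypothesis H_sq : whisk_l G H ⊙ cofree_act A = cofree_act B ⊙ H.

(** The left side of [H_sq] at [over a] pairs the image of [over a] with [x_tob o], so [over_of_act]
    applies. *)
Lemma lift_ob_sig x (o : x_ob G) (a : tob A x o) :
  {b : tob B x o | eob H (over a) = over b}.
Proof.
have [b e] := over_of_act (EFun_ob (over a) H_sq).
by case: o a b e => v g a b e; exists b.
Qed.

Definition lift_ob x (o : x_ob G) (a : tob A x o) : tob B x o := proj1_sig (lift_ob_sig a).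

Lemma lift_obE x (o : x_ob G) (a : tob A x o) : eob H (over a) = over (lift_ob a).
Proof. exact: proj2_sig (lift_ob_sig a). Qed.

(** This is [H_sq] on cells, with casts because [eob H (over a)] is [over (lift_ob a)] only
    propositionally. *)
Lemma lift_cell_sq x (o : x_ob G) x' (o' : x_ob G) (a : tob A x o) (a' : tob A x' o')
    (f : bhom x x') (h := tcast (lift_obE a) (lift_obE a') f ∘ ecell H (over a) (over a') f) :
  em_act (G := explicit G) (tfun B (lift_ob a) (lift_ob a') f) ∘ h =
  fmap (x_fun o o') h ∘ em_act (G := explicit G) (tfun A a a' f).
Proof.
have p y (q : x_ob G) (c : tob A y q) : eob (whisk_l G H) (cpair (over c) (x_tob q)) =
    cpair (over (lift_ob c)) (x_tob q) by rewrite /= lift_obE.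
have r y (q : x_ob G) (c : tob A y q) : eob (cofree_act B ⊙ H) (over c) =
    cpair (over (lift_ob c)) (x_tob q) by rewrite -H_sq; exact: p.
have -> : fmap (x_fun o o') h = tcast (p _ _ a) (p _ _ a') f ∘
    ecell (whisk_l G H) (cpair (over a) (x_tob o)) (cpair (over a') (x_tob o')) f.
  by rewrite /h fmap_comp (fmap_tcast _ _ (p _ _ a) (p _ _ a')).
(* With the coactions written as cells of [cofree_act], each side becomes a single cast of a cell of
   one composite in [H_sq]. *)
rewrite -!ecell_cofree_act /h.
have := tcast_comp_ecell (L := cofree_act B) (lift_obE a) (lift_obE a') eq_refl eq_refl
  (r _ _ a) (r _ _ a') f.
rewrite comp_idl => ->.
have := tcast_comp_ecell (L := whisk_l G H) (D := cofree_act A) (a := over a) (a' := over a')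
  eq_refl eq_refl (p _ _ a) (p _ _ a') (p _ _ a) (p _ _ a') f.
rewrite comp_idl => ->.
exact: (@tcast_ecell _ _ _ _ (cofree_act B ⊙ H) (whisk_l G H ⊙ cofree_act A) _ _ _ _
  (over a) (over a') _ _ (r _ _ a) (r _ _ a') (p _ _ a) (p _ _ a') f (eq_sym H_sq)).
Qed.

Definition lift_cell x (o : x_ob G) x' (o' : x_ob G) (a : tob A x o) (a' : tob A x' o')
    (f : bhom x x') : EMmor (tfun A a a' f) (tfun B (lift_ob a) (lift_ob a') f) :=
  {| em_sq := lift_cell_sq a a' f |}.

(** Equality of Eilenberg-Moore morphisms is tested on underlying 2-cells, so the laws are those of
    [H] carried along casts. *)
Program Definition lift_morphism : EFun A B :=
  {| eob := lift_ob; ecell := lift_cell |}.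
Next Obligation.
apply: EMmor_eq; exact: (cast_nat (lift_obE a) (lift_obE a') p).
Qed.
Next Obligation.
apply: EMmor_eq.
have := cast_mu (lift_obE a) (lift_obE a') (lift_obE a'') x' x.
by rewrite /= !comp_idr.
Qed.
Next Obligation.
apply: EMmor_eq.
have := cast_eta (lift_obE a).
by rewrite /= !comp_idr.
Qed.

Lemma whisk_lift_morphism : whisk_l U lift_morphism = H.
Proof.
apply: EFun_ext => x v x' v' [o a u] [o' a' u'] f; destruct u, u'.
symmetry; exact: (@ecell_sig_cast _ _ _ _ H (whisk_l U lift_morphism) _ _ _ _
  (over a) (over a') (lift_obE a) (lift_obE a') f eq_refl).
Qed.
End LiftMorphism.

Lemma comparison_F1_surj (A B : Caten X E) (H : c1 (T A) (T B)) :
  exists F, F1 T F = H.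
Proof.
exists (lift_morphism (cm_sq H)); apply: CoalgMor_eq; exact: whisk_lift_morphism.
Qed.

(** * Essential surjectivity: lifting a coalgebra to [V^G] *)

Section LiftCoalgebra.
Context (A : TwoSided X V) (α : EFun A (Caten_comp G A)).
Hypothesis counit : (lunit A ⊙ whisk_r (cc_e G) A) ⊙ α = EFun_id A.
Hypothesis coassoc : (assoc G G A ⊙ whisk_r (cc_d G) A) ⊙ α = whisk_l G α ⊙ α.

(** The counit of [G] sends [g] to an object of the identity, which exists only over the diagonal;
    the counit law then identifies the other component with [a]. *)
Lemma coaction_diag x v (a : tob A x v) : {g : tob G v v | eob α a = cpair a g}.
Proof.
have := EFun_ob a counit; rewrite /= /lunit_ob /=.
case: (eob α a) => u l g /= h.
have e : u = v by case: (eob (cc_e G) g).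
subst u; move: h; rewrite (id_ob_K (eob (cc_e G) g)) => ->.
by exists g.
Qed.

(** The object [g] of [G] with [α a = (a, g)], which [coaction_diag] provides, is
    the only possible choice of [a_+] in [V^G]. *)
Definition lifted_ob x (o : x_ob G) : Type :=
  {a : tob A x (x_0 o) | eob α a = cpair a (x_tob o)}.

Definition lifted_act x (o : x_ob G) x' (o' : x_ob G) (a : lifted_ob x o)
    (a' : lifted_ob x' o') (f : bhom x x') :
    tfun A (proj1_sig a) (proj1_sig a') f ~>
    x_fun o o' (tfun A (proj1_sig a) (proj1_sig a') f) :=
  tcast (proj2_sig a) (proj2_sig a') f ∘ ecell α (proj1_sig a) (proj1_sig a') f.

(** The left side is a cast of a cell of the composite in [counit], hence of an identity cell. *)
Lemma lifted_counit x (o : x_ob G) x' (o' : x_ob G) (a : lifted_ob x o)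
    (a' : lifted_ob x' o') (f : bhom x x') :
  x_e (tfun A (proj1_sig a) (proj1_sig a') f) ∘ lifted_act a a' f = idm _.
Proof.
pose L := lunit A ⊙ whisk_r (cc_e G) A.
have p y (q : x_ob G) (c : lifted_ob y q) :
    eob L (cpair (proj1_sig c) (x_tob q)) = proj1_sig c.
  by rewrite /L /= (x_e_ob q).
have p2 y (q : x_ob G) (c : lifted_ob y q) :
    eob (L ⊙ α) (proj1_sig c) = proj1_sig c.
  exact: eq_trans (f_equal (fun d => eob L d) (proj2_sig c)) (p _ _ c).
have -> : x_e (tfun A (proj1_sig a) (proj1_sig a') f) =
    tcast (p _ _ a) (p _ _ a') f ∘ ecell L (cpair (proj1_sig a) (x_tob o))
      (cpair (proj1_sig a') (x_tob o')) f.
  by rewrite /x_e (lunit_cell_cast _ _ (p _ _ a) (p _ _ a')) /L /= comp_assoc.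
rewrite /lifted_act (tcast_comp_ecell (proj2_sig a) (proj2_sig a') (p _ _ a) (p _ _ a')
  (p2 _ _ a) (p2 _ _ a')).
by rewrite (tcast_ecell _ _ eq_refl eq_refl _ counit) /= comp_idl.
Qed.

Lemma coassoc_cast_r x (o : x_ob G) x' (o' : x_ob G) (a : tob A x (x_0 o))
    (a' : tob A x' (x_0 o')) (c : tob (Caten_comp G G) (x_0 o) (x_0 o))
    (c' : tob (Caten_comp G G) (x_0 o') (x_0 o'))
    (K : c = cpair (x_tob o) (x_tob o)) (K' : c' = cpair (x_tob o') (x_tob o'))
    (f : bhom x x')
    (p : cpair (B := G) (cpair a (lft c)) (rgt c) = cpair (cpair a (x_tob o)) (x_tob o))
    (p' : cpair (B := G) (cpair a' (lft c')) (rgt c') =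
      cpair (cpair a' (x_tob o')) (x_tob o')) :
  tcast K K' (tfun A a a' f) = tcast p p' f.
Proof. by subst c c'; rewrite !tcast_id. Qed.

(** Once the casts are gathered on the outside, the two sides are cells of the two composites in
    [coassoc], cast to the common objects [t]. *)
Lemma lifted_coassoc x (o : x_ob G) x' (o' : x_ob G) (a : lifted_ob x o)
    (a' : lifted_ob x' o') (f : bhom x x') :
  x_d (tfun A (proj1_sig a) (proj1_sig a') f) ∘ lifted_act a a' f =
  fmap (x_fun o o') (lifted_act a a' f) ∘ lifted_act a a' f.
Proof.
pose L := assoc G G A ⊙ whisk_r (cc_d G) A.
pose R := whisk_l G α.
pose b y (q : x_ob G) (c : lifted_ob y q) := cpair (proj1_sig c) (x_tob q).
pose t y (q : x_ob G) (c : lifted_ob y q) := cpair (b _ _ c) (x_tob q).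
have p y (q : x_ob G) (c : lifted_ob y q) : eob L (b _ _ c) = t _ _ c.
  by rewrite /L /= (x_d_ob q).
have p2 y (q : x_ob G) (c : lifted_ob y q) : eob (L ⊙ α) (proj1_sig c) = t _ _ c.
  exact: eq_trans (f_equal (fun d => eob L d) (proj2_sig c)) (p _ _ c).
have r y (q : x_ob G) (c : lifted_ob y q) : eob R (b _ _ c) = t _ _ c.
  by rewrite /R /= (proj2_sig c).
have r2 y (q : x_ob G) (c : lifted_ob y q) : eob (R ⊙ α) (proj1_sig c) = t _ _ c.
  exact: eq_trans (f_equal (fun d => eob R d) (proj2_sig c)) (r _ _ c).
have -> : x_d (tfun A (proj1_sig a) (proj1_sig a') f) =
    tcast (p _ _ a) (p _ _ a') f ∘ ecell L (b _ _ a) (b _ _ a') f.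
  by rewrite /x_d (coassoc_cast_r _ _ _ (p _ _ a) (p _ _ a')) /L /= comp_idl.
have -> : fmap (x_fun o o') (lifted_act a a' f) =
    tcast (r _ _ a) (r _ _ a') f ∘ ecell R (b _ _ a) (b _ _ a') f.
  by rewrite /lifted_act fmap_comp (fmap_tcast _ _ (r _ _ a) (r _ _ a')).
rewrite /lifted_act.
rewrite (tcast_comp_ecell _ _ (p _ _ a) (p _ _ a') (p2 _ _ a) (p2 _ _ a')).
rewrite (tcast_comp_ecell _ _ (r _ _ a) (r _ _ a') (r2 _ _ a) (r2 _ _ a')).
exact: (tcast_ecell (p2 _ _ a) (p2 _ _ a') (r2 _ _ a) (r2 _ _ a') f coassoc).
Qed.

Definition lifted_coalg x (o : x_ob G) x' (o' : x_ob G) (a : lifted_ob x o)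
    (a' : lifted_ob x' o') (f : bhom x x') : EMcoalg (G := explicit G) o o' :=
  {| em_ob := tfun A (proj1_sig a) (proj1_sig a') f :
       bhom (g_0 (o : g_ob (explicit G))) (g_0 (o' : g_ob (explicit G)));
     em_act := lifted_act a a' f;
     em_counit := lifted_counit a a' f; em_coassoc := lifted_coassoc a a' f |}.

(** Naturality of [α] makes the maps of [A] morphisms of coalgebras; its compatibility with [eta]
    and [mu] does the same for the structure 2-cells below. *)
Program Definition lifted_fun x (o : E) x' (o' : E) (a : lifted_ob x o)
    (a' : lifted_ob x' o') : Functor (bhom x x') (bhom o o') :=
  {| fobj := lifted_coalg a a' : bhom x x' -> EMhom (G := explicit G) o o';
     fmap := fun f f' p => {| em_mor := fmap (tfun A (proj1_sig a) (proj1_sig a')) p |} |}.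
Next Obligation. exact: (cast_nat (proj2_sig a) (proj2_sig a') p). Qed.
Next Obligation. apply: EMmor_eq; exact: fmap_id. Qed.
Next Obligation. apply: EMmor_eq; exact: fmap_comp. Qed.

Program Definition lifted_eta x (o : E) (a : lifted_ob x o) :
    id1 o ~> lifted_fun a a (id1 x) :=
  {| em_mor := teta A (proj1_sig a) |} :
    EMmor (EM_id (G := explicit G) o) (lifted_coalg a a (id1 x)).
Next Obligation. exact: (cast_eta (proj2_sig a)). Qed.

Program Definition lifted_mu x (o : E) x' (o' : E) x'' (o'' : E) (a : lifted_ob x o)
    (a' : lifted_ob x' o') (a'' : lifted_ob x'' o'') (f' : bhom x' x'') (f : bhom x x') :
    lifted_fun a' a'' f' # lifted_fun a a' f ~> lifted_fun a a'' (f' # f) :=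
  {| em_mor := tmu A (proj1_sig a) (proj1_sig a') (proj1_sig a'') f' f |} :
    EMmor (EM_tens (lifted_coalg a' a'' f') (lifted_coalg a a' f))
      (lifted_coalg a a'' (f' # f)).
Next Obligation.
apply: eq_trans (cast_mu (proj2_sig a) (proj2_sig a') (proj2_sig a'') f' f) _.
by rewrite /= -comp_assoc.
Qed.

Program Definition lifted : TwoSided X E :=
  {| tob := lifted_ob; tfun := lifted_fun; teta := lifted_eta; tmu := lifted_mu |}.
Next Obligation. apply: EMmor_eq; exact: tmu_nat. Qed.
Next Obligation. apply: EMmor_eq; exact: tmu_ass. Qed.
Next Obligation. apply: EMmor_eq; exact: tmu_lun. Qed.
Next Obligation. apply: EMmor_eq; exact: tmu_run. Qed.

(** * The isomorphism between [U ∘ lifted] and the given coalgebra *)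

Definition counit_ob x v (c : tob (Caten_comp U lifted) x v) : tob A x v :=
  match rgt c in U_ob o v return lifted_ob x o -> tob A x v with
  | U_obI _ => fun a => proj1_sig a
  end (lft c).

Definition counit_cell x v x' v' (c : tob (Caten_comp U lifted) x v)
    (c' : tob (Caten_comp U lifted) x' v') (f : bhom x x') :
    tfun (Caten_comp U lifted) c c' f ~> tfun A (counit_ob c) (counit_ob c') f :=
  match rgt c as u in U_ob o v, rgt c' as u' in U_ob o' v'
    return forall (a : lifted_ob x o) (a' : lifted_ob x' o'),
      tfun (Caten_comp U lifted) (Cob o a u) (Cob o' a' u') f ~>
      tfun A (counit_ob (Cob o a u)) (counit_ob (Cob o' a' u')) f with
  | U_obI _, U_obI _ => fun a a' => idm (tfun A (proj1_sig a) (proj1_sig a') f)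
  end (lft c) (lft c').

Ltac split_U c := let u := fresh in destruct c as [? ? u]; destruct u.

Program Definition lifted_counit_fun : EFun (Caten_comp U lifted) A :=
  {| eob := counit_ob; ecell := counit_cell |}.
Next Obligation. by split_U a; split_U a'; rewrite /= comp_idl comp_idr. Qed.
Next Obligation.
by split_U a; split_U a'; split_U a''; rewrite /= htens_id comp_idl !comp_idr.
Qed.
Next Obligation. by split_U a; rewrite /= comp_idl comp_idr. Qed.

Definition section_ob x v (a : tob A x v) : tob (Caten_comp U lifted) x v :=
  over (A := lifted) (o := existT (fun u : V => tob G u u) v (proj1_sig (coaction_diag a)))
    (exist _ a (proj2_sig (coaction_diag a))).

(** The hom functors of [U ∘ lifted] at the chosen objects compute to those of [A], so identity
    cells suffice. *)
Program Definition section_fun : EFun A (Caten_comp U lifted) :=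
  {| eob := section_ob; ecell := fun _ _ _ _ a a' f => idm (tfun A a a' f) |}.
Next Obligation. by rewrite comp_idl comp_idr. Qed.
Next Obligation. by rewrite htens_id comp_idl !comp_idr. Qed.
Next Obligation. by rewrite comp_idl comp_idr. Qed.

Lemma counit_section : lifted_counit_fun ⊙ section_fun = EFun_id A.
Proof. by apply: EFun_ext => *; rewrite /ecell_sig /= comp_idl. Qed.

(** The object of [G] picked by [coaction_diag] is [x_tob o], as both are the second component of
    [α] at the same object. *)
Lemma section_ob_over x (o : x_ob G) (a : lifted_ob x o) :
  section_ob (proj1_sig a) = over (A := lifted) a.
Proof.
case: o a => v g [a e]; rewrite /section_ob /=.
case: (coaction_diag a) => g' e'; rewrite /=.
have d : g' = g by exact: proj2 (Cob_inj (eq_trans (eq_sym e') e)).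
by subst g'; rewrite (eq_irr e' e).
Qed.

Lemma section_counit : section_fun ⊙ lifted_counit_fun = EFun_id (Caten_comp U lifted).
Proof.
apply: EFun_ext => x v x' v' [o a u] [o' a' u'] f; destruct u, u'.
refine (@ecell_sig_cast _ _ _ _ (section_fun ⊙ lifted_counit_fun) (EFun_id _) _ _ _ _
  (over (A := lifted) a) (over (A := lifted) a')
  (section_ob_over a) (section_ob_over a') f _).
(* The cells of [lifted_counit_fun] are identities, so moving the cast through them shows that it is
   an identity. *)
have := ecell_tcast (F := lifted_counit_fun) (section_ob_over a) (section_ob_over a')
  eq_refl eq_refl f.
by rewrite /= !comp_idl !comp_idr.
Qed.

(** The coactions on [lifted] are by definition the cells of [α] cast along [proj2_sig], which is
    also the equality of objects needed here. *)
Lemma lifted_counit_sq :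
  whisk_l G lifted_counit_fun ⊙ cofree_act lifted = α ⊙ lifted_counit_fun.
Proof.
apply: EFun_ext => x v x' v' [o a u] [o' a' u'] f; destruct u, u'.
symmetry.
refine (@ecell_sig_cast _ _ _ _ (α ⊙ lifted_counit_fun)
  (whisk_l G lifted_counit_fun ⊙ cofree_act lifted) _ _ _ _
  (over (A := lifted) a) (over (A := lifted) a') (proj2_sig a) (proj2_sig a') f _).
by rewrite /= !comp_idr fmap_id !comp_idl.
Qed.
End LiftCoalgebra.

(** By [coalg_iso] it is enough to invert [lifted_counit_fun] as an enriched functor, and
    [section_fun] does so. *)
Lemma comparison_eso (b : CoalgTwoCat (induced X G)) :
  exists (a : Caten X E) (j : c1 (T a) b), is_iso1 j.
Proof.
case: b => A α h h'.
pose j : CoalgMor (T (lifted h h')) (Build_Coalg h h') :=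
  Build_CoalgMor (a := T (lifted h h')) (b := Build_Coalg h h')
    (cm_mor := lifted_counit_fun h h') (lifted_counit_sq h h').
exists (lifted h h'), j.
exact: (coalg_iso (j := j) (section_counit h h') (counit_section h h')).
Qed.
End LiftToCoalgebras.

Theorem proposition3p5 (V : Bicat) (G : Caten_comonad V) :
  @is_EM_object V G (EM (explicit G)) (EM_U (explicit G)) (EM_coaction G).
Proof.
move=> X; apply: local_iso_is_2equivalence.
- exact: comparison_F1_inj.
- exact: comparison_F1_surj.
- exact: comparison_F2_inj.
- exact: comparison_F2_surj.
- exact: comparison_eso.
Qed.
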